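(* Let $f:\mathbb{A}\to\mathbb{A}$ be a negative-torsion map of the annulus $\mathbb{A}=\mathbb{T}\times\mathbb{R}$. Let $\gamma:\mathbb{T}\to\mathbb{A}$ be a $\mathcal{C}^0$ essential curve such that $\gamma(\mathbb{T})$ is the graph of a function $\mathbb{T}\to\mathbb{R}$. Then there exists a point $z\in\gamma(\mathbb{T})$ of zero torsion, i.e. such that $\mathrm{Torsion}(f,z)$ exists and equals $0$.
   Context: $\mathbb{T}=\mathbb{R}/\mathbb{Z}$, $\mathbb{A}=\mathbb{T}\times\mathbb{R}$ with the standard Riemannian metric and the standard trivialization of its tangent bundle ($T_x\mathbb{A}\cong\mathbb{R}^2$), with the counterclockwise orientation. $\chi=(0,1)$ is the unit positive vertical vector. For non-zero vectors $u,v\in\mathbb{R}^2$, $\theta(u,v)\in\mathbb{T}$ is the oriented angle from $u$ to $v$, measured in turns (a full counterclockwise turn is $1$). An isotopy is an arc in $\mathrm{Diff}^1(\mathbb{A})$ continuous for the compact-open (weak) $\mathcal{C}^1$ topology. Let $f:\mathbb{A}\to\mathbb{A}$ be a $\mathcal{C}^1$ diffeomorphism isotopic to the identity, and $(f_t)_{t\in[0,1]}$ an isotopy with $f_0=\mathrm{Id}$, $f_1=f$; extend it to $t\in\mathbb{R}_+=[0,+\infty)$ by $f_t=f_{t-\lfloor t\rfloor}\circ f^{\lfloor t\rfloor}$, and write $I=(f_t)_{t\ge0}$. For $x\in\mathbb{A}$ and $\xi\in T_x\mathbb{A}\setminus\{0\}$ let $\tilde v(I,x,\xi):\mathbb{R}_+\to\mathbb{R}$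 be a continuous lift of $t\mapsto\theta(\chi,Df_t(x)\xi)\in\mathbb{T}$. For an integer $n\ge1$, $$\mathrm{Torsion}_n(f,x,\xi)=\frac{\tilde v(I,x,\xi)(n)-\tilde v(I,x,\xi)(0)}{n}.$$ This does not depend on the lift nor on the chosen isotopy. The torsion at $x$ is $\mathrm{Torsion}(f,x)=\lim_{n\to+\infty}\mathrm{Torsion}_n(f,x,\xi)$ whenever the limit exists; it does not depend on $\xi\neq0$. A negative-torsion map is a $\mathcal{C}^1$ diffeomorphism $f:\mathbb{A}\to\mathbb{A}$ isotopic to the identity such that $\mathrm{Torsion}_1(f,z,\chi)<0$ for every $z\in\mathbb{A}$. A ($\mathcal{C}^0$) essential curve is a $\mathcal{C}^0$ embedded circle $\gamma:\mathbb{T}\to\mathbb{A}$ not homotopic to a point. *)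

(* Defs.v *)
From HB Require Import structures.
From mathcomp Require Import all_boot all_order all_algebra.
From mathcomp Require Import all_classical all_reals all_analysis.
From mathcomp Require Import ring_quotient.
From mathcomp Require Import ring lra.

Set Implicit Arguments.
Unset Strict Implicit.
Unset Printing Implicit Defensive.

Import Order.TTheory GRing.Theory Num.Theory.
Import numFieldNormedType.Exports.

Local Open Scope classical_set_scope.
Local Open Scope quotient_scope.
Local Open Scope ring_scope.

(* Z as a subgroup of R: Num.int_num_subdef is the predicate underlying the
   qualifier Num.int, and it is the one that carries the subgroup structure. *)
Definition integers (R : realType) : zmodClosed R :=
  GRing.ZmodClosed.clone R (@Num.int_num_subdef R) _.

Definition circle (R : realType) : Type := {ideal_quot (integers R)}.

Section Circle.
Context {R : realType}.

HB.instance Definition _ := GRing.Zmodule.on (circle R).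
HB.instance Definition _ := Quotient.on (circle R).

(* The quotient topology. *)
Definition circle_open (U : set (circle R)) : Prop :=
  open (\pi_(circle R) @^-1` U).

Fact circle_openT : circle_open setT.
Proof. by rewrite /circle_open preimage_setT; exact: openT. Qed.

Fact circle_openI : setI_closed circle_open.
Proof. by move=> U V oU oV; exact: openI. Qed.

Fact circle_open_bigU (I : Type) (F : I -> set (circle R)) :
  (forall i, circle_open (F i)) -> circle_open (\bigcup_i F i).
Proof.
by move=> oF; rewrite /circle_open preimage_bigcup; 
  apply: bigcup_open => i _; exact: oF.
Qed.

HB.instance Definition _ := isOpenTopological.Build (circle R)
  circle_openT circle_openI circle_open_bigU.

Definition turn (x : R) : circle R := \pi_(circle R) x.

Lemma turn_eq (x y : R) : turn x = turn y <-> x - y \is a Num.int.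
Proof.
split=> [xy|xy].
  have /eqP : \pi_(circle R) x = \pi_(circle R) y := xy.
  by rewrite -Quotient.idealrBE.
apply/eqP; rewrite /turn.
by have := xy; rewrite -[_ \is a _]/(x - y \in integers R) Quotient.idealrBE.
Qed.

Lemma turnD (x y : R) : turn (x + y) = turn x + turn y.
Proof. exact: Quotient.pi_add. Qed.

Lemma turnN (x : R) : turn (- x) = - turn x.
Proof. exact: Quotient.pi_opp. Qed.

Lemma turn0 : turn 0 = 0.
Proof. by rewrite -[RHS](subrr (turn 0)) -turnN -turnD subrr. Qed.

(* The representative in [-1/2, 1/2[, i.e. the local inverse of turn at 0. *)
Definition circle_log (a : circle R) : R :=
  repr a - (Num.floor (repr a + 2^-1))%:~R.

Lemma circle_logK : cancel circle_log turn.
Proof.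
move=> a; rewrite -[RHS]reprK; apply/turn_eq; rewrite /circle_log.
by rewrite addrAC subrr add0r rpredN intr_int.
Qed.

Lemma circle_log_itv (a : circle R) : - 2^-1 <= circle_log a < 2^-1.
Proof.
rewrite /circle_log; have := floor_itv (repr a + 2^-1).
rewrite intrD /=; lra.
Qed.

End Circle.

Section Annulus.
Variable R : realType.

Definition annulus : Type := (circle R * R)%type.

(* The standard trivialization identifies every tangent space with R^2. *)
Definition tangent : Type := (R * R)%type.

Definition annulus_exp (h : tangent) : annulus := (turn h.1, h.2).

Definition annulus_log (x : annulus) : tangent := (circle_log x.1, x.2).

End Annulus.

Section Diffeomorphisms.
Context {R : realType}.
Local Notation A := (annulus R).
Local Notation TA := (annulus R * tangent R)%type.
Implicit Types (f g : A -> A) (x : A) (h xi : tangent R).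

(* f read in the charts h |-> x + annulus_exp h and h |-> f x + annulus_exp h,
   whose derivatives at 0 are the identity in the standard trivialization. *)
Definition local_expr f x h : tangent R :=
  annulus_log (f (x + annulus_exp h) - f x).

Definition annulus_differentiable f : Prop :=
  forall x, differentiable (local_expr f x) (0 : tangent R).

Definition annulus_diff f x : tangent R -> tangent R :=
  'd (local_expr f x) (0 : tangent R).

Definition tangent_map f : TA -> TA :=
  fun p => (f p.1, annulus_diff f p.1 p.2).

Definition C1_map f : Prop :=
  annulus_differentiable f /\ continuous (tangent_map f).

Definition C1_diffeo f : Prop :=
  C1_map f /\ exists g, [/\ C1_map g, cancel f g & cancel g f].

(* The weak C^1 topology on Diff^1 is the one induced by f |-> tangent_map f
   from the compact-open topology. *)
Definition isotopy (F : R -> A -> A) : Prop :=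
  {in `[0, 1], forall t, C1_diffeo (F t)} /\
  {within `[0, 1], continuous
    (fun t => tangent_map (F t) : {compact-open, TA -> TA})}.

Definition isotopy_from_id (F : R -> A -> A) f : Prop :=
  [/\ isotopy F, F 0 = id & F 1 = f].

Definition isotopic_to_id f : Prop := exists F, isotopy_from_id F f.

(* f_t = f_(t - floor t) o f^(floor t), meaningful for t >= 0. *)
Definition extended_isotopy (F : R -> A -> A) (t : R) : A -> A :=
  F (t - (Num.truncn t)%:R) \o iter (Num.truncn t) (F 1).

End Diffeomorphisms.

Section Angles.
Context {R : realType}.
Implicit Types (u v : tangent R) (s : R).

(* Counterclockwise rotation by s turns. *)
Definition rotation s u : tangent R :=
  (cos (2 * pi * s) * u.1 - sin (2 * pi * s) * u.2,
   sin (2 * pi * s) * u.1 + cos (2 * pi * s) * u.2).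

(* The class of s modulo 1 is unique, see thetaP. *)
Definition theta u v : circle R :=
  xget 0 [set a | exists s, a = turn s /\
                  exists2 r : R, 0 < r & v = r *: rotation s u].

Lemma cos_sin_turn (c d : R) : c ^+ 2 + d ^+ 2 = 1 ->
  exists s : R, cos (2 * pi * s) = c /\ sin (2 * pi * s) = d.
Proof.
move=> cd.
have c1 : -1 <= c <= 1 by apply/andP; split; nra.
have pi0 : pi != 0 :> R by rewrite gt_eqF// pi_gt0.
have sc : sin (acos c) = `|d|.
  by rewrite sin_acos// -cd addrAC subrr add0r sqrtr_sqr.
have ac : cos (acos c) = c by rewrite acosK// in_itv.
have half (y : R) : 2 * pi * (y / (2 * pi)) = y.
  by rewrite mulrC divfK // mulf_neq0.
have [d0|d0] := leP 0 d.
  by exists (acos c / (2 * pi)); rewrite half sc ac ger0_norm.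
exists (- acos c / (2 * pi)).
by rewrite half cosN sinN sc ac ltr0_norm// opprK.
Qed.

Lemma sinpi_nat n : sin (pi * n%:R) = 0 :> R.
Proof.
elim: n => [|n IHn]; first by rewrite mulr0 sin0.
by rewrite -natr1 mulrDr mulr1 sinDpi IHn oppr0.
Qed.

Lemma sinpi_int (n : int) : sin (pi * n%:~R) = 0 :> R.
Proof.
case: n => n; first exact: sinpi_nat.
by rewrite NegzE rmorphN mulrN sinN sinpi_nat oppr0.
Qed.

Lemma cos_turn_eq1 s : (cos (2 * pi * s) == 1) = (s \is a Num.int).
Proof.
have -> : 2 * pi * s = (pi * s) *+ 2 by rewrite mulr2n; ring.
have -> : (cos (pi * s *+ 2) == 1) = (sin (pi * s) == 0).
  rewrite cos_mulr2n cos2sin2 -sqrf_eq0; apply/eqP/eqP; lra.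
apply/eqP/idP => [ss|/intrP[n ->]]; last exact: sinpi_int.
pose r := s - (Num.floor s)%:~R.
have /andP[r0 r1] : 0 <= r < 1.
  by have := floor_itv s; rewrite /r intrD /=; lra.
have sr : sin (pi * r) = 0.
  by rewrite /r mulrBr sinB ss sinpi_int !(mul0r, mulr0) subr0.
have [r00|r_neq0] := eqVneq r 0.
  by move/eqP: r00; rewrite subr_eq0 => /eqP ->; exact: intr_int.
have : 0 < sin (pi * r).
  apply: sin_gt0_pi; rewrite mulr_gt0 ?pi_gt0 ?lt0r ?r_neq0 //=.
  by rewrite gtr_pMr ?pi_gt0.
by rewrite sr ltxx.
Qed.

Lemma thetaP u v s : u != 0 -> v != 0 ->
  theta u v = turn s <-> exists2 r : R, 0 < r & v = r *: rotation s u.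
Proof.
case: u v => [u1 u2] [v1 v2] u0 v0.
have sqr_gt0 (a b : R) : (a, b) != 0 -> 0 < a ^+ 2 + b ^+ 2.
  move=> ab0; rewrite lt0r addr_ge0 ?sqr_ge0 // andbT.
  apply: contra ab0; rewrite paddr_eq0 ?sqr_ge0 // !sqrf_eq0.
  by case/andP => /eqP -> /eqP ->.
move: u0 v0 => /sqr_gt0 u0 /sqr_gt0 v0.
set S := [set a | exists s, a = turn s /\
  exists2 r : R, 0 < r & (v1, v2) = r *: rotation s (u1, u2)].
have exS : exists s r, 0 < r /\ (v1, v2) = r *: rotation s (u1, u2).
  pose q := Num.sqrt ((v1 ^+ 2 + v2 ^+ 2) / (u1 ^+ 2 + u2 ^+ 2)).
  have q0 : 0 < q by rewrite sqrtr_gt0 divr_gt0.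
  have qq : q ^+ 2 = (v1 ^+ 2 + v2 ^+ 2) / (u1 ^+ 2 + u2 ^+ 2).
    by rewrite sqr_sqrtr // ltW // divr_gt0.
  pose N := u1 ^+ 2 + u2 ^+ 2.
  have N0 : N != 0 by rewrite gt_eqF.
  have q_neq0 : q != 0 by rewrite gt_eqF.
  have [|s' [cs sn]] := @cos_sin_turn ((u1 * v1 + u2 * v2) / (q * N))
                        ((u1 * v2 - u2 * v1) / (q * N)).
    rewrite !expr_div_n exprMn qq -/N -mulrDl.
    have vN0 : v1 ^+ 2 + v2 ^+ 2 != 0 by rewrite gt_eqF.
    rewrite /N; field; rewrite ?vN0 //=.
    by rewrite -/N N0.
  exists s', q; split=> //; rewrite /rotation /= cs sn.
  by congr (_, _); rewrite /GRing.scale /= /N; field; rewrite -/N N0 q_neq0.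
have uniqS s1 s2 (r1 r2 : R) : 0 < r1 -> 0 < r2 ->
    r1 *: rotation s1 (u1, u2) = r2 *: rotation s2 (u1, u2) ->
    turn s1 = turn s2.
  move=> r10 r20 [] /=; rewrite /GRing.scale /=.
  set c1 := cos _; set d1 := sin _; set c2 := cos _; set d2 := sin _ => e1 e2.
  have cd1 : c1 ^+ 2 + d1 ^+ 2 = 1 by exact: cos2Dsin2.
  have cd2 : c2 ^+ 2 + d2 ^+ 2 = 1 by exact: cos2Dsin2.
  have N0 : u1 ^+ 2 + u2 ^+ 2 != 0 by rewrite gt_eqF.
  have ec : r1 * c1 = r2 * c2.
    apply: (mulIf N0).
    have := congr1 ( *%R u1) e1; have := congr1 ( *%R u2) e2; lra.
  have ed : r1 * d1 = r2 * d2.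
    apply: (mulIf N0).
    have := congr1 ( *%R u2) e1; have := congr1 ( *%R u1) e2; lra.
  have rr : r1 = r2.
    apply/eqP; rewrite -(eqrXn2 (n := 2)) ?ltW //; apply/eqP.
    rewrite -[LHS]mulr1 -[RHS]mulr1 -{1}cd1 -cd2 !mulrDr -!exprMn ec ed.
    by [].
  move: ec ed; rewrite rr => /(mulfI (lt0r_neq0 r20)) ec.
  move=> /(mulfI (lt0r_neq0 r20)) ed.
  apply/turn_eq; rewrite -cos_turn_eq1 mulrBr cosB -/c1 -/c2 -/d1 -/d2.
  by rewrite ec ed -!expr2; apply/eqP.
rewrite /theta -/S; split.
  case: xgetP => [a -> [s' [-> [r r0 vr]]]|noS].
    move=> /turn_eq ss'; exists r => //; rewrite vr.
    move: ss'; rewrite -cos_turn_eq1 => /eqP c1.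
    have s1 : sin (2 * pi * (s' - s)) = 0.
      by apply: cos1sin0; rewrite c1 normr1.
    have -> : s' = (s' - s) + s by rewrite subrK.
    move: c1 s1; set w := s' - s => c1 s1.
    by rewrite /rotation mulrDr cosD sinD c1 s1 !(mul1r, mul0r, subr0, addr0) add0r.
  have [s' [r [r0 vr]]] := exS.
  by have /= := noS (turn s'); case; exists s'; split => //; exists r.
move=> [r r0 vr]; case: xgetP => [a -> [s' [-> [r' r'0 vr']]]|noS].
  by apply: (uniqS _ _ r' r) => //; rewrite -vr'.
by have /= := noS (turn s); case; exists s; split => //; exists r.
Qed.

End Angles.

Section Torsion.
Context {R : realType}.
Local Notation A := (annulus R).
Implicit Types (f : A -> A) (F : R -> A -> A) (x : A) (xi : tangent R).

Definition chi : tangent R := (0, 1).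

Definition angle_lift F x xi (v : R -> R) : Prop :=
  {within `[0, +oo[, continuous v} /\
  forall t, 0 <= t ->
    turn (v t) = theta chi (annulus_diff (extended_isotopy F t) x xi).

(* The value depends neither on the isotopy nor on the lift; the default 0 is
   irrelevant when f is isotopic to the identity and xi is non-zero, since an
   isotopy and a lift then exist. *)
Definition torsion_n n f x xi : R :=
  xget 0 [set tau | exists F v,
    [/\ isotopy_from_id F f, angle_lift F x xi v
      & tau = (v n%:R - v 0) / n%:R]].

Definition has_torsion f x (tau : R) : Prop :=
  forall xi, xi != 0 -> torsion_n n f x xi @[n --> \oo] --> tau.

Definition negative_torsion_map f : Prop :=
  [/\ C1_diffeo f, isotopic_to_id f & forall z, torsion_n 1 f z chi < 0].

End Torsion.

Section Curves.
Context {R : realType}.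

Definition embedding (S T : topologicalType) (g : S -> T) : Prop :=
  [/\ continuous g, injective g
    & forall U : set S, open U -> exists2 V : set T, open V & U = g @^-1` V].

Definition null_homotopic (S T : topologicalType) (g : S -> T) : Prop :=
  exists (H : S * R -> T) (c : T),
    [/\ {within setT `*` `[0, 1], continuous H},
        forall s, H (s, 0) = g s & forall s, H (s, 1) = c].

Definition essential_curve (gamma : circle R -> annulus R) : Prop :=
  embedding gamma /\ ~ null_homotopic gamma.

Definition graph (phi : circle R -> R) : set (annulus R) :=
  [set p | p.2 = phi p.1].

End Curves.

(* Main.v *)
(* Let v_n(x) be the variation of the angle of Df_t(x) chi over [0, n]. Negative
   torsion means that a vector which has turned past a vertical direction never
   comes back: v_n <= 0, and v_n(x) <= -1/2 implies v_(n+1)(x) < -1/2. So the sets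
   of points of the graph where v_n >= -1/2 are compact and decreasing, and it
   suffices to show that none is empty: a common point has v_n in [-1/2, 0] for
   all n, and the angle variation of any other tangent vector differs from v_n by
   at most 1/2.

   Let p0 be the point of the graph whose image under g = f^n is lowest. The region
   above the graph is mapped above the height of g(p0). Join the point p0 + (1, 0)
   of the universal cover to a point p0 + (0, h) just above p0 within that region,
   and follow the vector from p0 to the moving point p. Initially its angle goes
   from -1/4 to 0; it is constant in time for p = p0 + (1, 0); at the final time it
   stays in the upper half-plane, so its angle stays in [-1/4, 1/4]. Hence the
   vertical chord turns by at most 1/4, and the tangent vector chi by less than 1/2
   if h is small.

   This bound also gives the independence of v_n from the isotopy: two isotopies
   give values of v_n which differ by an integer, constant in x, and less than 1
   in absolute value at a lowest point. *)
Require Import Defs.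
From mathcomp Require Import all_boot all_order all_algebra generic_quotient.
From mathcomp Require Import all_classical all_reals all_analysis.
From mathcomp Require Import ring lra zify.

Set Implicit Arguments.
Unset Strict Implicit.
Unset Printing Implicit Defensive.

Import Order.TTheory GRing.Theory Num.Theory.
Import numFieldNormedType.Exports.

Local Open Scope classical_set_scope.
Local Open Scope ring_scope.

(** * The topology of the circle *)

Section CircleTopology.
Context {R : realType}.
Implicit Types (x y : R) (a b : circle R) (U : set R).

Lemma turn_repr a : turn (repr a) = a.
Proof. exact: reprK. Qed.

Lemma turnB x y : turn (x - y) = turn x - turn y.
Proof. by rewrite turnD turnN. Qed.

Lemma turn_continuous : continuous (@turn R).
Proof. by apply/continuousP => U oU. Qed.

(** The saturation of the image of [U] is the union of the integer translates of [U], all of them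
    open. *)
Lemma turn_open U : open U -> open [set turn x | x in U].
Proof.
move=> oU; rewrite -[open _]/(open (@turn R @^-1` [set turn x | x in U])).
have -> : @turn R @^-1` [set turn x | x in U]
    = \bigcup_(n in [set: int]) ((fun x => x + n%:~R) @^-1` U).
  apply/seteqP; split => x /=.
    move=> [u Uu /turn_eq /intrP[n un]]; exists n => //=.
    by rewrite -un addrC subrK.
  move=> [n _ Un]; exists (x + n%:~R) => //; apply/turn_eq.
  by rewrite addrAC subrr add0r intr_int.
apply: bigcup_open => n _; apply: open_comp => // x _.
by apply: continuousD; [exact: cvg_id|exact: cst_continuous].
Qed.

Lemma nbhs_turn x U : nbhs x U -> nbhs (turn x) [set turn y | y in U].
Proof.
rewrite nbhsE => -[V [oV Vx] VU]; rewrite nbhsE.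
exists [set turn y | y in V]; last by move=> _ [y Vy <-]; exists y => //;
  exact: VU.
by split; [exact: turn_open|exists x].
Qed.

(** Since [turn] is open, products of images of neighbourhoods are neighbourhoods, so continuity
    descends from the subtraction of [R]. *)
Lemma circle_subr_continuous :
  continuous (fun p : circle R * circle R => p.1 - p.2).
Proof.
move=> [a b]; rewrite -(turn_repr a) -(turn_repr b).
set x := repr a; set y := repr b => W /=.
rewrite -turnB => nW.
have /(_ _ nW) : turn (p.1 - p.2) @[p --> (x, y)] --> turn (x - y).
  apply: (continuous_comp (f := fun p : R * R => p.1 - p.2)).
    by apply: continuousB; [exact: cvg_fst|exact: cvg_snd].
  exact: turn_continuous.
move=> [[U V] [/= nU nV] UV].
exists ([set turn z | z in U], [set turn z | z in V]).
  by split; exact: nbhs_turn.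
move=> [_ _] [/= [u Uu <-] [v Vv <-]]; rewrite -turnB.
exact: (UV (u, v)).
Qed.

Lemma circle_log_turn x : - 2^-1 <= x < 2^-1 -> circle_log (turn x) = x.
Proof.
move=> x1; have := circle_log_itv (turn x).
have /turn_eq/intrP[n nE] : turn (circle_log (turn x)) = turn x.
  exact: circle_logK.
move=> y1; suff : n = 0 by move=> n0; move: nE; rewrite n0; lra.
have : -1 < (n%:~R : R) < 1 by rewrite -nE; lra.
rewrite -[1]/(1%:~R) -mulrNz !ltr_int; lia.
Qed.

(** The value -1/2 is the cut of [circle_log]. Away from it [circle_log] inverts the open map [turn]
    on ]-1/2, 1/2[. *)
Lemma circle_log_continuous a : - 2^-1 < circle_log a ->
  {for a, continuous (@circle_log R)}.
Proof.
move=> aN; have /andP[_ a1] := circle_log_itv a.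
move=> W nW; rewrite -(circle_logK a).
have : nbhs (circle_log a) (W `&` `]-2^-1, 2^-1[).
  apply: filterI => //; apply: near_in_itvoo; rewrite in_itv /=; exact/andP.
move/nbhs_turn; apply: filterS => _ [y [Wy /= yi] <-] /=.
by rewrite circle_log_turn//; move: yi; rewrite in_itv /=; lra.
Qed.

Lemma circle_log0 : circle_log (0 : circle R) = 0.
Proof. by rewrite -turn0 circle_log_turn//; lra. Qed.

Lemma circle_compact : compact [set: circle R].
Proof.
have -> : [set: circle R] = @turn R @` `[-2^-1, 2^-1].
  apply/seteqP; split => // a _; exists (circle_log a); last exact: circle_logK.
  by have := circle_log_itv a; rewrite /= in_itv /=; lra.
apply: continuous_compact; last exact: segment_compact.
by apply: continuous_subspaceT; exact: turn_continuous.
Qed.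

Lemma turn_eq0 x : (turn x == 0) = (cos (2 * pi * x) == 1).
Proof.
rewrite cos_turn_eq1 -turn0; apply/eqP/idP => [/turn_eq|]; rewrite ?subr0 //.
by move=> xi; apply/turn_eq; rewrite subr0.
Qed.

(** The complement of 0 is open because [turn x] vanishes exactly where [cos (2 * pi * x) = 1];
    continuity of subtraction then separates distinct points. *)
Lemma circle_hausdorff : hausdorff_space (circle R).
Proof.
move=> a b ab; apply/eqP; rewrite -subr_eq0; apply: contrapT => /negP ab0.
have oN : open [set c : circle R | c != 0].
  rewrite -[open _]/(open [set x : R | turn x != 0]).
  have -> : [set x : R | turn x != 0] =
      (fun x : R => cos (2 * pi * x)) @^-1` [set y | y != 1].
    by apply/seteqP; split => x /=; rewrite turn_eq0.
  apply: open_comp; last exact: open_neq.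
  move=> x _; apply: continuous_comp; last exact: continuous_cos.
  by apply: continuousM; [exact: cst_continuous|exact: cvg_id].
have [[U V] [/= nU nV] UV] := @circle_subr_continuous (a, b) _ (open_nbhs_nbhs
  (conj oN ab0)).
have [c [Uc Vc]] := ab _ _ nU nV.
by have := UV (c, c) (conj Uc Vc); rewrite /= subrr eqxx.
Qed.
End CircleTopology.

(** * Lifting to the universal cover of the circle *)

Section Lifting.
Context {R : realType}.
Implicit Types (s t : R).

Lemma cvg_circleB (S : Type) (F : set_system S) {FF : Filter F}
    (f g : S -> circle R) a b :
  f @ F --> a -> g @ F --> b -> f x - g x @[x --> F] --> a - b.
Proof.
move=> fa gb; apply: (@continuous2_cvg _ _ _ _ _ _ _ _ (fun a b => a - b)) fa
  gb.
exact: circle_subr_continuous (a, b).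
Qed.

Lemma cvg_prod (S : Type) (U V : topologicalType) (F : set_system S)
    {FF : Filter F} (f : S -> U) (g : S -> V) (a : U) (b : V) :
  f @ F --> a -> g @ F --> b -> (f x, g x) @[x --> F] --> ((a, b) : U * V).
Proof. by move=> fa gb; exact: (cvg_pair fa gb). Qed.

Lemma continuous_pair (S U V : topologicalType) (f : S -> U) (g : S -> V) :
  continuous f -> continuous g -> continuous (fun x => (f x, g x)).
Proof. by move=> cf cg x; apply: cvg_prod; [exact: cf|exact: cg]. Qed.

Lemma continuous_compT (S U V : topologicalType) (f : S -> U) (g : U -> V) :
  continuous f -> continuous g -> continuous (fun x => g (f x)).
Proof. by move=> cf cg x; apply: continuous_comp; [exact: cf|exact: cg]. Qed.

(** A retraction of the line onto [0, T] when [0 <= T]. Composing with it replaces continuity on a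
    segment by continuity on [R]. *)
Definition clamp (T t : R) : R := Num.max 0 (Num.min T t).

Lemma clamp_continuous T : continuous (clamp T).
Proof.
move=> t; apply: (@continuous_max R R^o (cst 0) (fun u => Num.min T u)).
  exact: cvg_cst.
by apply: (@continuous_min R R^o (cst T) id); [exact: cvg_cst|exact: cvg_id].
Qed.

Lemma clamp_id T t : 0 <= t <= T -> clamp T t = t.
Proof. by move=> /andP[t0 tT]; rewrite /clamp (min_r tT) (max_r t0). Qed.

Lemma clamp_le0 T t : t <= 0 -> clamp T t = 0.
Proof. by move=> t0; rewrite /clamp max_l// ge_min t0 orbT. Qed.

Lemma clamp_ge T t : 0 <= T <= t -> clamp T t = T.
Proof. by move=> /andP[T0 Tt]; rewrite /clamp (min_l Tt) (max_r T0). Qed.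

Lemma clamp_itv T t : 0 <= T -> 0 <= clamp T t <= T.
Proof. by move=> T0; rewrite /clamp le_max lexx /= ge_max T0 ge_min lexx. Qed.

Lemma itv_scale (u s b : R) : 0 <= u <= 1 -> 0 <= s <= b -> 0 <= u * s <= b.
Proof.
move=> /andP[u0 u1] /andP[s0 sb]; rewrite mulr_ge0//=.
by rewrite (le_trans _ sb)// ler_piMl.
Qed.

Lemma turn_sum n (h : nat -> R) :
  turn (\sum_(0 <= k < n) h k) = \sum_(0 <= k < n) turn (h k).
Proof. exact: (big_morph _ (@turnD R) (@turn0 R)). Qed.

Section Square.
Variables (g : R * R -> circle R) (T : R).
Hypothesis T0 : 0 <= T.
Hypothesis gc : forall s t, 0 <= s <= 1 -> 0 <= t <= T ->
  {for (s, t), continuous g}.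

(** For (s, t, u) in a compact box, the increment of [g] along the ray through (s, t), between the
    parameters u and u + i, is uniformly small for small i. N is chosen with 1/N below the resulting
    radius. *)
Lemma square_uniform : exists2 N, (0 < N)%N &
  forall s t k, 0 <= s <= 1 -> 0 <= t <= T -> (k < N)%N ->
  `|circle_log (g (k.+1%:R / N%:R * s, k.+1%:R / N%:R * t) -
                g (k%:R / N%:R * s, k%:R / N%:R * t))| < 4^-1.
Proof.
pose K : set (R * R * R) := ((`[0, 1] `*` `[0, T]) `*` `[0, 1])%classic.
have cK : compact K.
  by apply: compact_setX; [apply: compact_setX|]; exact: segment_compact.
pose P (i : R) (x : R * R * R) := `|circle_log
  (g ((x.2 + i) * x.1.1, (x.2 + i) * x.1.2) - g (x.2 * x.1.1, x.2 * x.1.2))| <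
    4^-1.
have /compact_near_coveringP/(_ R (nbhs (0 : R)) P _) := cK.
case=> [|e /= e0 eP].
  move=> [[s t] u] [[/= si ti] ui]; rewrite !in_itv /= in si ti ui.
  have us : 0 <= u * s <= 1 by exact: itv_scale.
  have ut : 0 <= u * t <= T by exact: itv_scale.
  have cvu : (fun z : (R * R * R) * R => circle_log
     (g ((z.1.2 + z.2) * z.1.1.1, (z.1.2 + z.2) * z.1.1.2) -
      g (z.1.2 * z.1.1.1, z.1.2 * z.1.1.2))) @ nbhs ((s, t, u), (0 : R)) --> (0
        : R).
    rewrite -[X in _ --> X]circle_log0 -(subrr (g (u * s, u * t))).
    apply: (@continuous_cvg _ _ _ _ _ _ (@circle_log R)).
      by apply: circle_log_continuous; rewrite subrr circle_log0; lra.
    have c1 : z.1.1.1 @[z --> nbhs ((s, t, u), (0 : R))] --> s.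
      apply: (cvg_comp (G := nbhs (s, t)) (fun z : (R * R * R) * R => z.1.1)
        fst).
        by apply: (cvg_comp (G := nbhs (s, t, u)) fst fst); exact: cvg_fst.
      exact: cvg_fst.
    have c2 : z.1.1.2 @[z --> nbhs ((s, t, u), (0 : R))] --> t.
      apply: (cvg_comp (G := nbhs (s, t)) (fun z : (R * R * R) * R => z.1.1)
        snd).
        by apply: (cvg_comp (G := nbhs (s, t, u)) fst fst); exact: cvg_fst.
      exact: cvg_snd.
    have c3 : z.1.2 @[z --> nbhs ((s, t, u), (0 : R))] --> u.
      apply: (cvg_comp (G := nbhs (s, t, u)) fst snd); first exact: cvg_fst.
      exact: cvg_snd.
    have c4 : z.2 @[z --> nbhs ((s, t, u), (0 : R))] --> (0 : R) by exact:
      cvg_snd.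
    apply: cvg_circleB; apply: (@continuous_cvg _ _ _ _ _ _ g); try exact: gc.
      have c34 : z.1.2 + z.2 @[z --> nbhs ((s, t, u), (0 : R))] --> u.
        by rewrite -[X in _ --> X]addr0; exact: cvgD.
      by apply: cvg_prod; exact: cvgM.
    by apply: cvg_prod; exact: cvgM.
  have : nbhs (0 : R) (fun y => `|y| < 4^-1).
    have : nbhs (0 : R) (ball (0 : R) 4^-1) by apply: nbhsx_ballx; lra.
    by apply: filterS => y; rewrite /ball /= sub0r normrN.
  by move=> /cvu [[A B] [/= nA nB] AB]; exists (A, B).
have [N Ne] : exists2 N, (0 < N)%N & N%:R^-1 < e.
  exists (Num.truncn e^-1).+1 => //.
  rewrite invf_plt ?posrE// ?ltr0n//.
  exact: truncnS_gt.
exists N => // s t k si ti kN.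
have N0 : 0 < N%:R :> R by rewrite ltr0n (leq_ltn_trans (leq0n k) kN).
have -> : k.+1%:R / N%:R = k%:R / N%:R + N%:R^-1 :> R.
  by rewrite -natr1 mulrDl mul1r.
have Nb : ball_ [eta Num.norm] 0 e (N%:R^-1 : R).
  by rewrite /ball_ /= sub0r normrN gtr0_norm// invr_gt0.
have := eP _ Nb (s, t, k%:R / N%:R); rewrite /P /=; apply.
rewrite /K /= !in_itv /= si ti; split => //.
by rewrite divr_ge0 ?ler0n//= ler_pdivrMr// mul1r ler_nat ltnW.
Qed.

(* The lift at p accumulates the increments of g along the segment from the
   origin to p, cut into N pieces on which g varies by less than a quarter
     turn. *)
Lemma square_lift (L0 : R) : turn L0 = g (0, 0) -> exists L : R * R -> R,
  [/\ continuous L, L (0, 0) = L0 & forall s t, 0 <= s <= 1 -> 0 <= t <= T ->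
  turn (L (s, t)) = g (s, t)].
Proof.
move=> L0E; have [N N0 gN] := square_uniform.
have N0R : 0 < N%:R :> R by rewrite ltr0n.
pose M (p : R * R) := L0 + \sum_(0 <= k < N) circle_log
  (g (k.+1%:R / N%:R * p.1, k.+1%:R / N%:R * p.2) -
   g (k%:R / N%:R * p.1, k%:R / N%:R * p.2)).
exists (fun p => M (clamp 1 p.1, clamp T p.2)); split.
- move=> [s t]; apply: (@cvgD _ R^o); first exact: cvg_cst.
  rewrite big_mkord; under eq_cvg do rewrite big_mkord.
  apply: (@cvg_big _ _ +%R); first by move=> x; exact: add_continuous.
  move=> [k /= kN] _.
  have us : 0 <= clamp 1 s <= 1 by apply: clamp_itv; lra.
  have ut : 0 <= clamp T t <= T by exact: clamp_itv.
  have kin (j : nat) : (j <= N)%N -> g (j%:R / N%:R * clamp 1 x.1, j%:R / N%:R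
    * clamp T x.2) @[x --> (s, t)] -->
    g (j%:R / N%:R * clamp 1 s, j%:R / N%:R * clamp T t).
    move=> jN; have ji : 0 <= (j%:R / N%:R : R) <= 1.
      by rewrite divr_ge0 ?ler0n//= ler_pdivrMr// mul1r ler_nat.
    apply: (@continuous_cvg _ _ _ _ _ _ g).
      by apply: gc; exact: itv_scale.
    apply: cvg_prod; apply: cvgM; try exact: cvg_cst.
      apply: (cvg_comp (G := nbhs s) fst (clamp 1)); first exact: cvg_fst.
      exact: clamp_continuous.
    apply: (cvg_comp (G := nbhs t) snd (clamp T)); first exact: cvg_snd.
    exact: clamp_continuous.
  apply: continuous_cvg; last by apply: cvg_circleB; apply: kin => //;
    exact: ltnW.
  apply: circle_log_continuous.
  by have := gN (clamp 1 s) (clamp T t) k us ut kN; rewrite ltr_norml; lra.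
- rewrite /M /= !clamp_id ?lexx//; last lra.
  rewrite big1 ?addr0// => k _.
  by rewrite !mulr0 subrr circle_log0.
move=> s t si ti; rewrite /M /= !clamp_id// turnD turn_sum L0E.
under eq_bigr do rewrite circle_logK.
rewrite (telescope_sumr (fun k => g (k%:R / N%:R * s, k%:R / N%:R * t)))//.
by rewrite divff ?gt_eqF// mul0r !mul0r !mul1r addrC subrK.
Qed.
End Square.

End Lifting.

(** * Lifts of angles *)

Section Angles.
Context {R : realType}.
Implicit Types (s t T : R) (w : tangent R).

Lemma theta_polar w s : w != 0 -> theta chi w = turn s <->
  exists2 r : R, 0 < r & w = (- (r * sin (2 * pi * s)), r * cos (2 * pi * s)).
Proof.
move=> w0; rewrite thetaP//; last by apply/eqP => -[/eqP]; rewrite oner_eq0.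
split=> -[r r0 ->]; exists r => //; rewrite /rotation /chi /=;
  by congr pair; rewrite /GRing.scale /= ?(mulr0, mulr1, add0r) ?sub0r ?mulrN.
Qed.

Lemma theta_polar_ex w : w != 0 -> exists s, theta chi w = turn s.
Proof. by exists (circle_log (theta chi w)); rewrite circle_logK. Qed.


(** With [s0] the angle of [w], [D] and [N] are the coordinates of [z] along the direction of [w]
    and along its counterclockwise quarter turn. Near [w] one has D > 0, and the angle of [z] is s0
    + atan (N / D) / (2 pi). *)
Lemma theta_continuous (w : R * R) : w != 0 ->
  {for w, continuous (theta (@chi R) : R * R -> circle R)}.
Proof.
move=> w_neq0; have [s0 /[dup] s0E] := theta_polar_ex w_neq0.
rewrite theta_polar// => -[r0 r0_gt0 wE].
set S := sin _ in wE; set C := cos _ in wE.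
have CS : C ^+ 2 + S ^+ 2 = 1 by exact: cos2Dsin2.
pose D (z : R * R) : R := - S * z.1 + C * z.2.
pose N (z : R * R) : R := - S * z.2 - C * z.1.
have cfst : {for w, continuous (fst : R * R -> R)} by exact: cvg_fst.
have csnd : {for w, continuous (snd : R * R -> R)} by exact: cvg_snd.
have cD : {for w, continuous D}.
  by rewrite /continuous_at; apply: cvgD; apply: cvgM => //; exact: cvg_cst.
have cN : {for w, continuous N}.
  by rewrite /continuous_at; apply: cvgB; apply: cvgM => //; exact: cvg_cst.
have Dw : D w = r0.
  by rewrite /D wE /= -[RHS]mulr1 -CS; ring.
have nD : \forall z \near w, 0 < D z.
  by apply: cvgr_gt cD _ _; rewrite Dw.
pose h z : circle R := turn (s0 + atan (N z / D z) / (2 * pi)).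
have pi_gt0 := pi_gt0 R.
have halfK (y : R) : 2 * pi * (y / (2 * pi)) = y.
  by rewrite mulrC divfK// mulf_neq0// gt_eqF.
have hE : \forall z \near w, h z = theta chi z.
  near=> z.
  have Dz : 0 < D z by near: z.
  apply/esym/theta_polar.
    by apply: contraTneq Dz => ->; rewrite /D /= !mulr0 addr0 ltxx.
  set q := N z / D z.
  have cq : 0 < cos (atan q).
    by rewrite cos_gt0_pihalf// atan_gtNpi2 atan_ltpi2.
  have sq : sin (atan q) = q * cos (atan q).
    have tq : sin (atan q) / cos (atan q) = q by exact: atanK.
    by rewrite -[LHS](divfK (lt0r_neq0 cq)) tq.
  exists (D z / cos (atan q)); first exact: divr_gt0.
  rewrite mulrDr halfK cosD sinD -/S -/C sq.
  have D_neq0 : D z != 0 by rewrite gt_eqF.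
  have c_neq0 : cos (atan q) != 0 by rewrite gt_eqF.
  rewrite [LHS]surjective_pairing; congr pair.
    have -> : - (D z / cos (atan q) * (S * cos (atan q) + C * (q * cos (atan
      q))))
      = - (S * D z + C * N z).
      by rewrite /q; field; rewrite D_neq0.
    by rewrite -[LHS]mul1r -CS /D /N; ring.
  have -> : D z / cos (atan q) * (C * cos (atan q) - S * (q * cos (atan q)))
      = C * D z - S * N z.
    by rewrite /q; field; rewrite D_neq0.
  by rewrite -[LHS]mul1r -CS /D /N; ring.
have hw : h w = theta chi w by exact: (nbhs_singleton hE).
suff : theta chi z @[z --> w] --> h w by rewrite hw.
apply: cvg_trans; first exact: near_eq_cvg hE.
apply: (@continuous_cvg _ _ _ _ _ _ (@turn R)); first exact: turn_continuous.
apply: cvgD; first exact: cvg_cst.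
apply: cvgM; last exact: cvg_cst.
apply: (@continuous_cvg _ _ _ _ _ _ (@atan R)); first exact: continuous_atan.
apply: cvgM => //; apply: cvgV => //; by rewrite Dw gt_eqF.
Unshelve. all: by end_near. Qed.

Lemma IVT_continuous (f : R -> R) T v : 0 <= T -> continuous f ->
  Num.min (f 0) (f T) <= v <= Num.max (f 0) (f T) ->
  exists2 t, 0 <= t <= T & f t = v.
Proof.
move=> T0 cf vi; have [|t tT ftv] := @IVT R f 0 T v T0 _ vi.
  exact: continuous_subspaceT.
by exists t => //; move: tT; rewrite in_itv.
Qed.

Lemma int_valued_cst (f : R -> R) T : 0 <= T -> continuous f ->
  (forall t, 0 <= t <= T -> f t \is a Num.int) -> f T = f 0.
Proof.
move=> T0 cf fi; apply/eqP; apply: contrapT => /negP fT.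
have /intrP[m mE] := fi 0 ltac:(lra).
have /intrP[n nE] := fi T ltac:(lra).
have mn : m != n by apply: contra fT => /eqP mn; rewrite mE nE mn.
(* Distinct integers are at distance at least 1, so the half-integer just above the smaller one is
   attained. *)
have [] := @IVT_continuous f T (Num.min (f 0) (f T) + 2^-1) T0 cf.
  rewrite mE nE; have [mn'|nm|/eqP] := ltgtP (m%:~R : R) n%:~R.
  - move: mn'; rewrite ltr_int -lezD1 -(ler_int R) intrD /=; lra.
  - move: nm; rewrite ltr_int -lezD1 -(ler_int R) intrD /=; lra.
  - by rewrite eqr_int (negPf mn).
move=> t tT ftE; have /intrP[k kE] := fi t tT.
have [l lE] : exists l : int, Num.min (f 0) (f T) = l%:~R.
  by rewrite mE nE; have [_|_] := leP (m%:~R : R) n%:~R; [exists m|exists n].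
have : (2 * (k - l) = 1)%R.
  apply: (@intr_inj R); rewrite intrM intrB -kE -lE ftE /=; lra.
lia.
Qed.

Lemma cos_lt0_turn x : 4^-1 < x <= 2^-1 -> cos (2 * pi * x) < 0 :> R.
Proof.
move=> xi; have pi0 := pi_gt0 R.
have -> : 2 * pi * x = 2 * pi * (x - 2^-1) + pi by field.
rewrite cosDpi oppr_lt0; apply: cos_gt0_pihalf; apply/andP; split; nra.
Qed.

(** To leave [-1/4, 1/4] from above, [b] would have to take a value in ]1/4, 1/2], where the cosine
    is negative. The lower side follows by symmetry. *)
Lemma half_plane_stable (b : R -> R) T : 0 <= T -> continuous b ->
  (forall t, 0 <= t <= T -> 0 <= cos (2 * pi * b t)) -> `|b 0| <= 4^-1 ->
  `|b T| <= 4^-1.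
Proof.
move=> T0.
have up (c : R -> R) : continuous c ->
    (forall t, 0 <= t <= T -> 0 <= cos (2 * pi * c t)) -> c 0 <= 4^-1 ->
    c T <= 4^-1.
  move=> cc cpos c0; rewrite leNgt; apply/negP => cT.
  have [] := @IVT_continuous c T (Num.min (c T) 2^-1) T0 cc.
    by have [?|?] := leP (c T) 2^-1; have [?|?] := leP (c 0) (c T);
      apply/andP; split; lra.
  move=> t ti ctE; have := cpos t ti; rewrite ctE leNgt cos_lt0_turn//.
  by rewrite lt_min cT /= ge_min lexx orbT andbT; lra.
move=> cb bpos; rewrite !ler_norml => /andP[b0 b1]; apply/andP; split.
  have : - b T <= 4^-1.
    apply: (up (fun t => - b t)); last by lra.
      by move=> t; apply: cvgN; exact: cb.
    by move=> t ti; rewrite mulrN cosN; exact: bpos.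
  by lra.
exact: up.
Qed.

Lemma sin_turn_eq0 x : (sin (2 * pi * x) == 0 :> R) = (2 * x \is a Num.int).
Proof.
rewrite -cos_turn_eq1 (_ : 2 * pi * (2 * x) = (2 * pi * x) *+ 2); last by ring.
by rewrite cos_mulr2n cos2sin2 -sqrf_eq0; apply/eqP/eqP; lra.
Qed.

(** Continuity is asked on all of [R] and the angle only on [0, T], which avoids subspace
    topologies. *)
Definition lifts (u : R -> tangent R) T (v : R -> R) : Prop :=
  continuous v /\ forall t, 0 <= t <= T -> turn (v t) = theta chi (u t).

Lemma lifts_uniq u T v v' : 0 <= T -> lifts u T v -> lifts u T v' ->
  v T - v 0 = v' T - v' 0.
Proof.
move=> T0 [cv vE] [cv' v'E].
suff : v T - v' T = v 0 - v' 0 by lra.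
apply: (@int_valued_cst (fun t => v t - v' t)) => //.
  by move=> t; apply: cvgB; [exact: cv|exact: cv'].
by move=> t ti; apply/turn_eq; rewrite vE// v'E.
Qed.

Lemma lifts_exist (u : R -> R * R) T s : 0 <= T -> continuous u ->
  (forall t, 0 <= t <= T -> u t != 0) -> turn s = theta chi (u 0) ->
  exists2 v, lifts u T v & v 0 = s.
Proof.
move=> T0 cu u0 sE.
have [|L [cL L0 LE]] := @square_lift R (fun p => theta chi (u p.2)) T T0 _ s sE.
  move=> a t _ ti; apply: (@continuous_cvg _ _ _ _ _ _ (theta chi)).
    by apply: theta_continuous; exact: u0.
  by apply: (cvg_comp (G := nbhs t) snd u); [exact: cvg_snd|exact: cu].
exists (fun t => L (0, t)) => //; split; last by move=> t ti;
  rewrite LE// lexx ler01.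
apply: (@continuous_compT _ _ _ (fun t => (0, t)) L) => //.
by apply: continuous_pair; [exact: cst_continuous|move=> t; exact: cvg_id].
Qed.

Definition cross (u w : tangent R) : R := u.1 * w.2 - u.2 * w.1.
Definition dot (u w : tangent R) : R := u.1 * w.1 + u.2 * w.2.

Lemma cross_polar (u w : tangent R) a b : u != 0 -> w != 0 ->
  turn a = theta chi u -> turn b = theta chi w ->
  exists2 r, 0 < r & cross u w = r * sin (2 * pi * (b - a)).
Proof.
move=> u0 w0 /esym/(theta_polar _ u0)[r r_gt0 ->] /esym/(theta_polar _ w0)[q
  q_gt0 ->].
exists (r * q); first exact: mulr_gt0.
by rewrite /cross /= mulrBr sinB; ring.
Qed.

Lemma dot_polar (u w : tangent R) a b : u != 0 -> w != 0 ->
  turn a = theta chi u -> turn b = theta chi w ->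
  exists2 r, 0 < r & dot u w = r * cos (2 * pi * (b - a)).
Proof.
move=> u0 w0 /esym/(theta_polar _ u0)[r r_gt0 ->] /esym/(theta_polar _ w0)[q
  q_gt0 ->].
exists (r * q); first exact: mulr_gt0.
by rewrite /dot /= mulrBr cosB; ring.
Qed.

(* The difference of the two angles cannot cross a multiple of 1/2, since the
   vectors would become parallel there. *)
Lemma lifts_le (u w : R -> tangent R) T (a b : R -> R) (k : int) : 0 <= T ->
  lifts u T a -> lifts w T b ->
  (forall t, 0 <= t <= T -> u t != 0 /\ w t != 0) ->
  (forall t, 0 <= t <= T -> (cross (u t) (w t) == 0) = (cross (u 0) (w 0) ==
    0)) ->
  a 0 - b 0 <= k%:~R / 2 -> a T - b T <= k%:~R / 2.
Proof.
move=> T0 [ca aE] [cb bE] uw0 uwc ab0.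
have cab : continuous (fun t => b t - a t).
  by move=> t; apply: cvgB; [exact: cb|exact: ca].
have crossE t : 0 <= t <= T ->
    (cross (u t) (w t) == 0) = (2 * (b t - a t) \is a Num.int).
  move=> ti; have [ut wt] := uw0 t ti.
  have [r r0 ->] := cross_polar ut wt (aE t ti) (bE t ti).
  by rewrite mulf_eq0 gt_eqF//= sin_turn_eq0.
have [c0|c0] := boolP (cross (u 0) (w 0) == 0).
  have : 2 * (b T - a T) = 2 * (b 0 - a 0); last by lra.
  apply: (@int_valued_cst (fun t => 2 * (b t - a t))) => //.
    by move=> t; apply: cvgM; [exact: cvg_cst|exact: cab].
  by move=> t ti; rewrite -crossE// uwc.
rewrite leNgt; apply/negP => abT.
have [] := @IVT_continuous (fun t => b t - a t) T (- (k%:~R / 2)) T0 cab.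
  by rewrite ge_min le_max; apply/andP; split; apply/orP; [right|left]; lra.
move=> t ti abt; move: c0; rewrite -(uwc _ ti) crossE// abt.
by rewrite (_ : 2 * _ = - k%:~R) ?rpredN ?intr_int//; field.
Qed.

(** Let k/2 be the least multiple of 1/2 above the initial difference of the angles. By [lifts_le]
    the final difference is at most k/2, which exceeds the initial one by less than 1/2. *)
Lemma lifts_close (u w : R -> tangent R) T (a b : R -> R) : 0 <= T -> lifts u T
  a -> lifts w T b ->
  (forall t, 0 <= t <= T -> u t != 0 /\ w t != 0) ->
  (forall t, 0 <= t <= T -> (cross (u t) (w t) == 0) = (cross (u 0) (w 0) ==
    0)) ->
  (a T - a 0) - (b T - b 0) <= 2^-1.
Proof.
move=> T0 la lb uw0 uwc.
have := @lifts_le u w T a b (Num.ceil (2 * (a 0 - b 0))) T0 la lb uw0 uwc.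
have := ceil_itv (2 * (a 0 - b 0)).
rewrite intrB /=; set c := (Num.ceil _)%:~R; move=> /andP[c1 c2] H.
have : a T - b T <= c / 2 by apply: H; lra.
lra.
Qed.

End Angles.

(** * Diffeomorphisms of the annulus *)

Section Topology.

Lemma hausdorff_prod (U V : topologicalType) :
  hausdorff_space U -> hausdorff_space V -> hausdorff_space (U * V)%type.
Proof.
move=> hU hV [a b] [c d] ab; congr pair.
- apply: hU => A C nA nC.
  have [||[x y] [[/= Ax _] [/= Cx _]]] := ab (A `*` setT) (C `*` setT).
  + by exists (A, setT) => //; split => //; exact: filterT.
  + by exists (C, setT) => //; split => //; exact: filterT.
  + by exists x.
- apply: hV => A C nA nC.
  have [||[x y] [[/= _ Ax] [/= _ Cx]]] := ab (setT `*` A) (setT `*` C).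
  + by exists (setT, A) => //; split => //; exact: filterT.
  + by exists (setT, C) => //; split => //; exact: filterT.
  + by exists y.
Qed.

Lemma locally_compact_prod (U V : topologicalType) :
  hausdorff_space U -> hausdorff_space V ->
  locally_compact [set: U] -> locally_compact [set: V] ->
  locally_compact [set: U * V].
Proof.
move=> hU hV lU lV [a b] _.
have [A] := lU a I; rewrite withinET => nA [cA _].
have [B] := lV b I; rewrite withinET => nB [cB _].
exists (A `*` B); first by rewrite withinET; exists (A, B).
have cAB : compact (A `*` B) by exact: compact_setX.
by split=> //; apply: compact_closed => //; exact: hausdorff_prod.
Qed.

Lemma continuous_retract (X S T : topologicalType) (A : set S) (r : X -> S)
    (h : S -> T) : continuous r -> (forall x, A (r x)) ->
  {within A, continuous h} -> continuous (fun x => h (r x)).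
Proof.
move=> cr rA /subspace_continuousP ch x W nW.
have /cr := ch _ (rA x) _ nW.
by rewrite /nbhs /=; apply: filterS => y; apply.
Qed.

End Topology.

Section Diffeo.
Context {R : realType}.
Local Notation A := (annulus R).
Local Notation TA := ((circle R * R) * (R * R))%type.
Implicit Types (f g : A -> A) (x : A) (h xi : tangent R).

Lemma annulus_logK x : annulus_exp (annulus_log x) = x.
Proof. by case: x => a b; rewrite /annulus_exp /= circle_logK. Qed.

Lemma annulus_exp0 : annulus_exp (0 : tangent R) = 0 :> A.
Proof. by rewrite /annulus_exp /= turn0. Qed.

Lemma annulus_log0 : annulus_log (0 : A) = 0.
Proof. by rewrite /annulus_log /= circle_log0. Qed.

Lemma local_expr0 f x : local_expr f x 0 = 0.
Proof. by rewrite /local_expr annulus_exp0 addr0 subrr annulus_log0. Qed.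

Lemma local_expr_comp g f x :
  local_expr (g \o f) x = local_expr g (f x) \o local_expr f x.
Proof.
apply/funext => h; rewrite /local_expr /= annulus_logK.
by rewrite [f x + _]addrC subrK.
Qed.

Lemma annulus_diff_comp g f x : annulus_differentiable f ->
  annulus_differentiable g ->
  annulus_diff (g \o f) x = annulus_diff g (f x) \o annulus_diff f x.
Proof.
move=> df dg; rewrite /annulus_diff local_expr_comp.
by rewrite [LHS]diff_comp ?local_expr0.
Qed.

Lemma tangent_map_comp g f : annulus_differentiable f ->
  annulus_differentiable g ->
  tangent_map (g \o f) = tangent_map g \o tangent_map f.
Proof.
by move=> df dg; apply/funext => -[x h];
  rewrite /tangent_map /= annulus_diff_comp.
Qed.

Lemma C1_map_comp g f : C1_map f -> C1_map g -> C1_map (g \o f).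
Proof.
move=> [df cf] [dg cg]; split; last first.
  rewrite tangent_map_comp// => p.
  by apply: continuous_comp; [exact: cf|exact: cg].
move=> x; rewrite local_expr_comp.
by apply: differentiable_comp; rewrite ?local_expr0.
Qed.

Lemma C1_diffeo_comp g f : C1_diffeo f -> C1_diffeo g -> C1_diffeo (g \o f).
Proof.
move=> [Cf [f' [Cf' ff' f'f]]] [Cg [g' [Cg' gg' g'g]]].
split; first exact: C1_map_comp.
exists (f' \o g'); split; first exact: C1_map_comp.
- by move=> x /=; rewrite gg' ff'.
- by move=> x /=; rewrite f'f g'g.
Qed.

Lemma C1_diffeo_id f : C1_diffeo f -> C1_diffeo (@id A).
Proof.
move=> [Cf [g [Cg fg gf]]]; have Cid : C1_map (@id A).
  by rewrite (_ : id = g \o f); [exact: C1_map_comp|apply/funext => x /=;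
    rewrite fg].
by split => //; exists id.
Qed.

(** Near 0 the identity read in the charts is the identity, because [circle_log] inverts [turn] on
    vectors of norm less than 1/2. *)
Lemma annulus_diff_id x : annulus_differentiable (@id A) ->
  annulus_diff id x = id.
Proof.
move=> did; apply/funext => v; rewrite /annulus_diff -deriveE//.
rewrite (@near_eq_derive _ _ _ _ id).
  exact: derive_id.
near=> h; rewrite /local_expr /= [x + _]addrC addrK.
rewrite /annulus_log /annulus_exp /= circle_log_turn;
  first by rewrite -surjective_pairing.
have : `|h| < 2^-1.
  near: h; apply: (filterS (P := ball (0 : R * R) 2^-1)).
    by move=> h; rewrite -ball_normE /= sub0r normrN.
  by apply: nbhsx_ballx; lra.
by rewrite prod_normE gt_max ltr_norml => /andP[/andP[h1 h2] _]; rewrite ltW.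
Unshelve. all: by end_near. Qed.

Lemma annulus_diff_inj f x : C1_diffeo f -> injective (annulus_diff f x).
Proof.
move=> Cf; have [[did _] _] := C1_diffeo_id Cf.
case: Cf => -[df _] [g [[dg _] fg gf]].
apply: (can_inj (g := annulus_diff g (f x))) => v.
rewrite -[LHS]/((annulus_diff g (f x) \o annulus_diff f x) v).
rewrite -annulus_diff_comp// (_ : g \o f = id) ?annulus_diff_id//.
by apply/funext => y /=; rewrite fg.
Qed.

Lemma annulus_diff_linear f x (a : R) v w :
  annulus_diff f x (a *: v + w) = a *: annulus_diff f x v + annulus_diff f x w.
Proof. exact: linearP. Qed.

Lemma annulus_diff_eq0 f x v : C1_diffeo f -> (annulus_diff f x v == 0) = (v ==
  0).
Proof.
move=> Cf; have d0 : annulus_diff f x 0 = 0 by exact: linear0.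
by rewrite -{1}d0 (inj_eq (annulus_diff_inj Cf)).
Qed.

Lemma annulus_diff_neq0 f x v : C1_diffeo f -> v != 0 -> annulus_diff f x v !=
  0.
Proof. by move=> Cf v0; rewrite annulus_diff_eq0. Qed.

Lemma cross_eq0P (u w : tangent R) :
  cross u w == 0 <-> exists a b, (a, b) != (0, 0) :> R * R /\ a *: u + b *: w =
    0.
Proof.
case: u w => [u1 u2] [w1 w2]; rewrite /cross /=; split; last first.
  move=> [a [b [ab0 [e1 e2]]]]; rewrite /= in e1 e2.
  change (a * u1 + b * w1 = 0) in e1; change (a * u2 + b * w2 = 0) in e2.
  apply: contraNT ab0 => c0; apply/eqP; congr pair; apply: (mulIf c0);
    rewrite mul0r.
    rewrite [LHS](_ : _ = w2 * (a * u1 + b * w1) - w1 * (a * u2 + b * w2));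
      last by ring.
    by rewrite e1 e2; ring.
  rewrite [LHS](_ : _ = u1 * (a * u2 + b * w2) - u2 * (a * u1 + b * w1));
    last by ring.
  by rewrite e1 e2; ring.
move=> /eqP c0.
have [u0|] := eqVneq (u1, u2) (0, 0).
  exists 1, 0; rewrite xpair_eqE oner_eq0; split=> //.
  by rewrite u0 scaler0 scale0r addr0.
rewrite xpair_eqE negb_and => /orP[u10|u20].
  exists w1, (- u1); rewrite xpair_eqE oppr_eq0 (negPf u10) andbF; split=> //.
  congr pair; first by change (w1 * u1 + - u1 * w1 = 0); ring.
  by change (w1 * u2 + - u1 * w2 = 0); lra.
exists w2, (- u2); rewrite xpair_eqE oppr_eq0 (negPf u20) andbF; split=> //.
congr pair; first by change (w2 * u1 + - u2 * w1 = 0); lra.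
by change (w2 * u2 + - u2 * w2 = 0); ring.
Qed.

(** The cross product vanishes exactly on linearly dependent pairs, and an injective linear map
    preserves and reflects dependence. *)
Lemma cross_annulus_diff f x v w : C1_diffeo f ->
  (cross (annulus_diff f x v) (annulus_diff f x w) == 0) = (cross v w == 0).
Proof.
move=> Cf; have lin a b : a *: annulus_diff f x v + b *: annulus_diff f x w =
    annulus_diff f x (a *: v + b *: w).
  rewrite annulus_diff_linear -[b *: w]addr0 annulus_diff_linear.
  by rewrite [annulus_diff f x 0]linear0 addr0.
by apply/idP/idP => /cross_eq0P [a [b [ab0 e0]]]; apply/cross_eq0P; exists a, b;
  split => //; apply/eqP; [rewrite -(annulus_diff_eq0 x _ Cf) -lin e0
  |rewrite lin annulus_diff_eq0// e0].
Qed.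

Lemma is_derive_cvg (F : R -> R) (a l : R) :
  k^-1 * (F (a + k) - F a) @[k --> (0 : R)^'] --> l -> is_derive a 1 F l.
Proof.
move=> Fl; have : k^-1 *: ((F \o shift a) (k *: 1) - F a) @[k --> (0 : R)^']
  --> l.
  have -> : (fun k : R => k^-1 *: ((F \o shift a) (k *: 1) - F a)) =
      (fun k : R => k^-1 * (F (a + k) - F a)).
    by apply/funext => k /=; rewrite [k *: 1]mulr1 [k + a]addrC.
  exact: Fl.
move=> {}Fl; apply: DeriveDef; first by apply/cvg_ex; exists l.
exact: (cvg_lim (@Rhausdorff R)).
Qed.

Lemma vertical_quotient f (a : circle R) (b : R) : annulus_differentiable f ->
  k^-1 * circle_log ((f (a, b + k)).1 - (f (a, b)).1) @[k --> (0 : R)^'] -->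
    (annulus_diff f (a, b) chi).1 /\
  k^-1 * ((f (a, b + k)).2 - (f (a, b)).2) @[k --> (0 : R)^'] -->
    (annulus_diff f (a, b) chi).2.
Proof.
move=> df; have d := df (a, b).
have dv : derivable (local_expr f (a, b)) 0 (chi : R * R) by exact:
  diff_derivable.
have := deriveE chi d; rewrite /derive.
have : (fun k : R => k^-1 *: ((local_expr f (a, b) \o shift 0) (k *: chi) -
    local_expr f (a, b) 0)) =
  (fun k : R => (k^-1 * circle_log ((f (a, b + k)).1 - (f (a, b)).1),
             k^-1 * ((f (a, b + k)).2 - (f (a, b)).2))).
  apply/funext => k; rewrite local_expr0 subr0 /= addr0 /local_expr.
  have -> : (a, b) + annulus_exp (k *: chi) = (a, b + k) :> A.
    congr pair; rewrite /=.
      by rewrite [k *: 0]mulr0 turn0 addr0.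
    by rewrite [k *: 1]mulr1.
  by [].
move=> qE; rewrite qE => limE.
have cq : (k^-1 * circle_log ((f (a, b + k)).1 - (f (a, b)).1),
             k^-1 * ((f (a, b + k)).2 - (f (a, b)).2))
   @[k --> (0 : R)^'] --> (annulus_diff f (a, b) chi : R * R).
  rewrite /annulus_diff -limE -qE; exact: dv.
set l : R * R := annulus_diff f (a, b) chi in cq *.
have cfst : {for l, continuous (fst : R * R -> R)} by exact: cvg_fst.
have csnd : {for l, continuous (snd : R * R -> R)} by exact: cvg_snd.
by split; [exact: (continuous_cvg _ cfst cq)|exact: (continuous_cvg _ csnd cq)].
Qed.

Lemma circle_locally_compact : locally_compact [set: circle R].
Proof.
move=> a _; exists setT; first by rewrite withinET; exact: filterT.
by split; [exact: circle_compact|exact: closedT].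
Qed.

(** The tangent bundle is locally compact and Hausdorff, so continuity in time for the compact-open
    topology becomes joint continuity in time and tangent vector. *)
Lemma isotopy_continuous (F : R -> A -> A) : isotopy F ->
  continuous (fun q : R * TA => tangent_map (F (clamp 1 q.1)) q.2 : TA).
Proof.
move=> [CF cF].
have clampi (t : R) : clamp 1 t \in `[0, 1] by rewrite in_itv /= clamp_itv.
have hausRR : hausdorff_space (R * R)%type.
  by apply: hausdorff_prod; exact: Rhausdorff.
have hausCR : hausdorff_space (circle R * R)%type.
  by apply: hausdorff_prod; [exact: circle_hausdorff|exact: Rhausdorff].
have lcRR : locally_compact [set: R * R].
  by apply: locally_compact_prod; [exact: Rhausdorff|exact: Rhausdorff|
     exact: locally_compactR|exact: locally_compactR].
have lcCR : locally_compact [set: circle R * R].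
  by apply: locally_compact_prod; [exact: circle_hausdorff|exact: Rhausdorff|
     exact: circle_locally_compact|exact: locally_compactR].
pose G (t : R) (p : TA) : TA := tangent_map (F (clamp 1 t)) p.
suff : continuous (uncurry G).
  by rewrite (_ : uncurry G = fun q : R * TA => G q.1 q.2)//;
    apply/funext => -[].
apply: continuous_uncurry.
- exact: locally_compact_prod.
- exact: hausdorff_prod.
- by apply: (continuous_retract _ _ cF);
  [exact: clamp_continuous|exact: clampi].
- by move=> t; have [[]] := CF _ (clampi t).
Qed.

End Diffeo.

(** * Jointly continuous families of diffeomorphisms *)

Section Families.
Context {R : realType}.
Local Notation A := (annulus R).
Local Notation CR := (circle R * R)%type.
Local Notation TA := ((circle R * R) * (R * R))%type.
Implicit Types (f g : A -> A) (x : A) (h xi : tangent R).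

Definition smooth_family (E : R -> A -> A) : Prop :=
  [/\ E 0 = id, forall t, C1_diffeo (E t) &
      continuous (fun q : R * TA => tangent_map (E q.1) q.2 : TA)].

Section Family.
Variable E : R -> A -> A.
Hypothesis hE : smooth_family E.

Lemma family_continuous : continuous (fun q : R * CR => E q.1 q.2 : CR).
Proof.
have [_ _ cE] := hE.
have c1 : continuous (fun q : R * CR => (q.1, (q.2, (0 : R * R)))).
  apply: continuous_pair; first by move=> q; exact: cvg_fst.
  by apply: continuous_pair; [move=> q; exact: cvg_snd|exact: cst_continuous].
have c2 := continuous_compT c1 cE.
by apply: (continuous_compT c2 (g := fst)) => q; exact: cvg_fst.
Qed.

Lemma family_diff_continuous (xi : R * R) :
  continuous (fun q : R * CR => annulus_diff (E q.1) q.2 xi : R * R).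
Proof.
have [_ _ cE] := hE.
have c1 : continuous (fun q : R * CR => (q.1, (q.2, xi))).
  apply: continuous_pair; first by move=> q; exact: cvg_fst.
  by apply: continuous_pair; [move=> q; exact: cvg_snd|exact: cst_continuous].
have c2 := continuous_compT c1 cE.
by apply: (continuous_compT c2 (g := snd)) => q; exact: cvg_snd.
Qed.

Lemma family_inj t : injective (E t).
Proof. by have [_ /(_ t)[_ [g [_ Eg _]]] _] := hE; exact: can_inj Eg. Qed.

Lemma family_diffable t : annulus_differentiable (E t).
Proof. by have [_ /(_ t)[[]]] := hE. Qed.

End Family.

(** Suppose that a point above the graph and a point below it both have images lower than [y0]. The
    images are joined by a segment of the universal cover that stays lower than [y0]. Its preimage
    meets the graph, at a point whose image is at height at least [y0]: a contradiction. *)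
Lemma separation (g g' : A -> A) (phi : circle R -> R) (y0 : R) :
  continuous (g' : CR -> CR) -> cancel g g' -> cancel g' g -> continuous phi ->
  (forall a, y0 <= (g (a, phi a)).2) ->
  (forall x, phi x.1 <= x.2 -> y0 <= (g x).2) \/
  (forall x, x.2 <= phi x.1 -> y0 <= (g x).2).
Proof.
move=> cg' gg' g'g cphi ymin; apply: contrapT => /not_orP[].
move=> /existsNP[p /not_implyP[p1 /negP]]; rewrite -ltNge => p2.
move=> /existsNP[q /not_implyP[q1 /negP]]; rewrite -ltNge => q2.
pose a := circle_log (g p).1; pose b := circle_log (g q).1.
pose c (u : R) : CR := (turn (a + u * (b - a)), (g p).2 + u * ((g q).2 - (g
  p).2)).
have cc : continuous c.
  apply: continuous_pair.
    apply: (continuous_compT (g := @turn R)); last exact: turn_continuous.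
    by move=> u; apply: cvgD; [exact: cvg_cst|apply: cvgM;
      [exact: cvg_id|exact: cvg_cst]].
  by move=> u; apply: cvgD; [exact: cvg_cst|apply: cvgM;
    [exact: cvg_id|exact: cvg_cst]].
have cz := continuous_compT cc cg'.
pose D (u : R) : R := (g' (c u)).2 - phi (g' (c u)).1.
have cD : continuous D.
  have c2 : continuous (fun u => (g' (c u)).2).
    by apply: (continuous_compT cz (g := snd)) => z; exact: cvg_snd.
  have c1 : continuous (fun u => (g' (c u)).1).
    by apply: (continuous_compT cz (g := fst)) => z; exact: cvg_fst.
  by move=> u; apply: cvgB; [exact: c2|exact: (continuous_compT c1 cphi)].
have D0 : 0 <= D 0.
  rewrite /D (_ : c 0 = g p) ?gg' ?subr_ge0//.
  by rewrite /c !mul0r !addr0 circle_logK -surjective_pairing.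
have D1 : D 1 <= 0.
  rewrite /D (_ : c 1 = g q) ?gg' ?subr_le0//.
  by rewrite /c !mul1r !subrKC circle_logK -surjective_pairing.
have [] := @IVT_continuous R D 1 0 ler01 cD;
  first by rewrite ge_min le_max D0 D1 orbT.
move=> u ui /eqP; rewrite subr_eq0 => /eqP Du.
have := ymin (g' (c u)).1; rewrite -Du -surjective_pairing g'g /= leNgt.
move=> /negP; apply; move: p2 q2; set P := (g p).2; set Q := (g q).2 => P0 Q0.
have /andP[u0 u1] := ui; have [QP|/ltW PQ] := leP Q P.
  by have := mulr_ge0_le0 u0 (_ : Q - P <= 0); lra.
by have := ler_piMl (_ : 0 <= Q - P) u1; lra.
Qed.

End Families.

(** * Chords from the lowest point of a graph *)

Section Chord.
Context {R : realType}.
Local Notation A := (annulus R).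
Local Notation CR := (circle R * R)%type.

Lemma int_small (x : R) : x \is a Num.int -> -1 < x < 1 -> x = 0.
Proof.
move=> /intrP[n ->]; rewrite -[1]/(1%:~R) -mulrNz !ltr_int => n1.
by rewrite (_ : n = 0)//; lia.
Qed.

Lemma theta_vertical (h : R) : h != 0 ->
  theta chi (0, h) = turn (if 0 < h then 0 else 2^-1).
Proof.
move=> h0; have w0 : (0, h) != 0 :> tangent R.
  by apply: contra h0 => /eqP[->].
apply/(theta_polar _ w0); exists `|h|; first by rewrite normr_gt0.
have [h_gt0|h_le0] := ltP 0 h.
  by rewrite !mulr0 sin0 cos0 mulr0 oppr0 mulr1 gtr0_norm.
have -> : 2 * pi * 2^-1 = pi :> R by field.
by rewrite sinpi cospi mulr0 oppr0 mulrN1 ler0_norm// opprK.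
Qed.

Lemma theta_horizontal (d : R) : d = 1 \/ d = -1 ->
  theta chi (d, 0) = turn (- d / 4).
Proof.
move=> d1; have w0 : (d, 0) != 0 :> tangent R.
  by apply/eqP => -[d0]; case: d1 => /eqP;
    rewrite d0 ?oppr_eq0// eq_sym ?oppr_eq0 oner_eq0.
apply/(theta_polar _ w0); exists 1 => //; rewrite !mul1r.
case: d1 => ->.
  have -> : 2 * pi * (- 1 / 4) = - (pi / 2) :> R by field.
  by rewrite sinN cosN sin_pihalf cos_pihalf opprK.
have -> : 2 * pi * (- -1 / 4) = pi / 2 :> R by field.
by rewrite sin_pihalf cos_pihalf.
Qed.

Variables (E : R -> A -> A) (T : R).

(** [l] follows, in the universal cover, the horizontal displacement between the images of the ends
    of a vertical segment of signed length [h]. *)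
Definition chord_lift (p : CR) (h : R) (l : R -> R) : Prop :=
  [/\ continuous l, l 0 = 0 & forall t, 0 <= t <= T ->
    turn (l t) = (E t (p.1, p.2 + h)).1 - (E t p).1].

Definition chord (p : CR) (h : R) (l : R -> R) (t : R) : R * R :=
  (l t, (E t (p.1, p.2 + h)).2 - (E t p).2).

Variables (phi : circle R -> R) (s0 : R).
Hypothesis hE : smooth_family E.
Hypothesis T0 : 0 <= T.
Hypothesis cphi : continuous phi.
Let p0 : CR := (turn s0, phi (turn s0)).

(* A path from the point [p0 + (d, 0)] of the universal cover to [p0 + (0, h)],
   above the graph of phi if [0 < h] and below it if [h < 0]. *)
Definition detour (d h s : R) : CR :=
  (turn (s0 + d * (1 - s)), phi (turn (s0 + d * (1 - s))) + s * h).

Lemma detour_continuous d h : continuous (detour d h).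
Proof.
have c1 : continuous (fun s : R => turn (s0 + d * (1 - s))).
  apply: (continuous_compT (g := @turn R)); last exact: turn_continuous.
  move=> s; apply: cvgD; first exact: cvg_cst.
  by apply: cvgM; [exact: cvg_cst|apply: cvgB; [exact: cvg_cst|exact: cvg_id]].
apply: continuous_pair => //.
have c2 := continuous_compT c1 cphi.
by move=> s; apply: cvgD; [exact: c2|apply: cvgM;
  [exact: cvg_id|exact: cvg_cst]].
Qed.

Lemma chord_turn (d h : R) : d = 1 \/ d = -1 -> h != 0 ->
  (forall s, 0 <= s <= 1 -> (E T p0).2 <= (E T (detour d h s)).2) ->
  exists l b, [/\ chord_lift p0 h l, lifts (chord p0 h l) T b,
    b 0 = (if 0 < h then 0 else - d / 2) & `|b T| <= 4^-1].
Proof.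
move=> d1 h0 above.
have i0 : 0 <= (0 : R) <= T by rewrite lexx.
have iT : 0 <= T <= T by rewrite lexx T0.
have i1 : 0 <= (1 : R) <= 1 by rewrite ler01 lexx.
have turnd : turn d = 0.
  by case: d1 => ->; rewrite -turn0; apply/turn_eq;
    rewrite subr0 ?rpredN rpred1.
have detour0 : detour d h 0 = p0.
  by rewrite /detour subr0 mulr1 mul0r addr0 turnD turnd addr0.
have detour1 : detour d h 1 = (p0.1, p0.2 + h).
  by rewrite /detour subrr mulr0 addr0 mul1r.
have cpos : continuous (fun p : R * R => E p.2 (detour d h p.1) : CR).
  have c1 : continuous (fun p : R * R => (p.2, detour d h p.1)).
    apply: continuous_pair; first by move=> p; exact: cvg_snd.
    apply: continuous_compT (@detour_continuous d h).
    by move=> p; exact: cvg_fst.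
  exact: (continuous_compT c1 (family_continuous hE)).
have cp0 : continuous (fun p : R * R => E p.2 p0 : CR).
  have c1 : continuous (fun p : R * R => (p.2, p0)).
    apply: continuous_pair; first by move=> p; exact: cvg_snd.
    exact: cst_continuous.
  exact: (continuous_compT c1 (family_continuous hE)).
have cfst : continuous (fst : CR -> circle R) by move=> z; exact: cvg_fst.
have csnd : continuous (snd : CR -> R) by move=> z; exact: cvg_snd.
pose g (p : R * R) := (E p.2 (detour d h p.1)).1 - (E p.2 p0).1.
have cg : continuous g.
  have c1 := continuous_compT cpos cfst; have c2 := continuous_compT cp0 cfst.
  by move=> p; apply: cvg_circleB; [exact: c1|exact: c2].
have g0 t : g (0, t) = 0 by rewrite /g /= detour0 subrr.
have [||L [cL L0 LE]] := @square_lift R g T T0 _ d.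
- by move=> s t _ _; exact: cg.
- by rewrite turnd g0.
have cLt s : continuous (fun t => L (s, t)).
  apply: (continuous_compT _ cL); apply: continuous_pair.
    exact: cst_continuous.
  by move=> ?; exact: cvg_id.
have cLs t : continuous (fun s => L (s, t)).
  apply: (continuous_compT _ cL); apply: continuous_pair.
    by move=> ?; exact: cvg_id.
  exact: cst_continuous.
have L0t t : 0 <= t <= T -> L (0, t) = d.
  move=> /andP[t0 tT]; rewrite -L0.
  have : L (0, t) - d = L (0, 0) - d; last by lra.
  apply: (@int_valued_cst R (fun u => L (0, u) - d) t t0).
    by move=> u; apply: cvgB; [exact: cLt|exact: cvg_cst].
  move=> u ui; apply/turn_eq; rewrite LE ?lexx ?ler01//; last lra.
  by rewrite g0 turnd.
have Ls0 s : 0 <= s <= 1 -> L (s, 0) = d * (1 - s).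
  move=> /andP[s_ge0 s1].
  have : L (s, 0) - d * (1 - s) = L (0, 0) - d * (1 - 0); last by rewrite L0;
    lra.
  apply: (@int_valued_cst R (fun u => L (u, 0) - d * (1 - u)) s s_ge0).
    move=> u; apply: cvgB; first exact: cLs.
    by apply: cvgM; [exact: cvg_cst|apply: cvgB;
      [exact: cvg_cst|exact: cvg_id]].
  move=> u ui; apply/turn_eq; rewrite LE//; last lra.
  have [E0 _ _] := hE.
  by rewrite /g /= E0 /= turnD addrAC subrr add0r.
pose w (p : R * R) : R * R := (L p, (E p.2 (detour d h p.1)).2 - (E p.2 p0).2).
have cw : continuous w.
  apply: continuous_pair => //.
  have c1 := continuous_compT cpos csnd; have c2 := continuous_compT cp0 csnd.
  by move=> p; apply: cvgB; [exact: c1|exact: c2].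
(* By injectivity a zero would put the detour point at [p0] in the annulus, so s = 0 or s = 1. At s
   = 0 the lifted displacement is [d], and at s = 1 the heights before the motion differ by [h]. *)
have w_neq0 s t : 0 <= s <= 1 -> 0 <= t <= T -> w (s, t) != 0.
  move=> si ti; apply/eqP => -[/= Lst0 e2].
  have e1 : (E t (detour d h s)).1 = (E t p0).1.
    by apply/eqP; rewrite -subr_eq0 -[_ - _]/(g (s, t)) -LE// Lst0 turn0.
  have /(family_inj hE)[e3 e4] : E t (detour d h s) = E t p0.
    rewrite [LHS]surjective_pairing [RHS]surjective_pairing e1; congr pair.
    by apply/eqP; rewrite -subr_eq0 e2.
  have : d * (1 - s) \is a Num.int.
    have /turn_eq : turn (s0 + d * (1 - s)) = turn s0 by [].
    by rewrite addrAC subrr add0r.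
  have [s_0|s_neq0] := eqVneq s 0.
    by move: Lst0; rewrite s_0 L0t// => d0; case: d1 => d1; lra.
  have s_gt0 : 0 < s by rewrite lt0r s_neq0; case/andP: si.
  move=> /int_small d1s; have : d * (1 - s) = 0.
    by apply: d1s; case: d1 => ->; lra.
  have s1 : d * (1 - s) = 0 -> s = 1 by case: d1 => ->; lra.
  move=> /s1 s1'; move: e4; rewrite -[LHS]/(detour d h s).2 s1' detour1 /=.
  by move=> e4; move/eqP: h0; apply; lra.
have [||al [cal al0 alE]] := @square_lift R (fun p => theta chi (w p)) T T0 _
  (- d / 4).
- move=> s t si ti; apply: continuous_comp; first exact: cw.
  by apply: theta_continuous; exact: w_neq0.
- rewrite (_ : w (0, 0) = (d, 0)) ?theta_horizontal//.
  by rewrite /w L0 /= detour0 subrr.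
have calt s : continuous (fun t => al (s, t)).
  apply: (continuous_compT _ cal); apply: continuous_pair.
    exact: cst_continuous.
  by move=> ?; exact: cvg_id.
have cals t : continuous (fun s => al (s, t)).
  apply: (continuous_compT _ cal); apply: continuous_pair.
    by move=> ?; exact: cvg_id.
  exact: cst_continuous.
have polar s t : 0 <= s <= 1 -> 0 <= t <= T -> exists2 r, 0 < r &
    w (s, t) = (- (r * sin (2 * pi * al (s, t))), r * cos (2 * pi * al (s, t))).
  by move=> si ti; apply/(theta_polar _ (w_neq0 _ _ si ti)); rewrite alE.
(* At s = 0 the detour point is a deck translate of [p0], so the vector is (d, 0) at every time. *)
have al0T : al (0, T) = - d / 4.
  rewrite -al0; have : al (0, T) - (- d / 4) = al (0, 0) - (- d / 4);
    last by lra.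
  apply: (@int_valued_cst R (fun t => al (0, t) - (- d / 4)) T T0).
    by move=> u; apply: cvgB; [exact: calt|exact: cvg_cst].
  move=> u ui; apply/turn_eq; rewrite alE ?lexx ?ler01//.
  rewrite (_ : w (0, u) = (d, 0)) ?theta_horizontal//.
  by rewrite /w L0t//= detour0 subrr.
(* At time T the hypothesis [above] keeps the vector in the closed upper half-plane. *)
have alT : `|al (1, T)| <= 4^-1.
  apply: (@half_plane_stable R (fun s => al (s, T)) 1) => //.
    move=> s si; have [r r0 [_ e]] := polar s T si iT.
    by rewrite -(pmulr_rge0 _ r0) -e subr_ge0; exact: above.
  by rewrite al0T; case: d1 => ->; rewrite ler_norml; lra.
(* At time 0 the horizontal coordinate keeps the sign of [d], so the angle stays within a quarter
   turn of -d/4. *)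
have al1 : `|al (1, 0) + d / 4| <= 4^-1.
  apply: (@half_plane_stable R (fun s => al (s, 0) + d / 4) 1) => //.
  - by move=> s; apply: cvgD; [exact: cals|exact: cvg_cst].
  - move=> s si; have [r r0 [e _]] := polar s 0 si i0.
    rewrite -(pmulr_rge0 _ r0); move: e; rewrite Ls0//.
    case: d1 => ->.
      have -> : 2 * pi * (al (s, 0) + 1 / 4) = 2 * pi * al (s, 0) + pi / 2 by
        field.
      by rewrite cosDpihalf mulrN => <-; lra.
    have -> : 2 * pi * (al (s, 0) + - 1 / 4) = 2 * pi * al (s, 0) - pi / 2 by
      field.
    rewrite cosB cos_pihalf sin_pihalf; lra.
  - by rewrite al0 ler_norml; case: d1 => ->; lra.
exists (fun t => L (1, t)), (fun t => al (1, t)); split => //.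
- split => //; first by rewrite Ls0// subrr mulr0.
  by move=> t ti; rewrite LE// /g /= detour1.
- split => // t ti; rewrite alE//.
  by rewrite /w /chord /= detour1.
(* The angle of the initial chord is known modulo 1, and [al1] selects the representative: 0 if h >
   0 and -d/2 if h < 0. *)
have : turn (al (1, 0)) = turn (if 0 < h then 0 else 2^-1).
  rewrite -theta_vertical// alE//; rewrite /w Ls0//=.
  have [E0 _ _] := hE.
  by rewrite E0 detour1 subrr mulr0 /= addrAC subrr add0r.
move/turn_eq; move: al1; rewrite ler_norml.
case: ifP => _ al1 ali.
  have := int_small ali; rewrite subr0; apply.
  by case: d1 al1 => ->; lra.
case: d1 al1 => -> al1.
  have : al (1, 0) - 2^-1 + 1 = 0; last by lra.
  by apply: int_small; [rewrite rpredD ?rpred1|lra].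
have : al (1, 0) - 2^-1 = 0; last by lra.
by apply: int_small; [|lra].
Qed.

End Chord.

(** * Short vertical chords and vertical tangent vectors *)

Section Crossing.
Context {R : realType}.
Local Notation A := (annulus R).
Local Notation CR := (circle R * R)%type.
Variables (E : R -> A -> A) (T : R).
Hypothesis hE : smooth_family E.
Hypothesis T0 : 0 <= T.

Lemma chord_lift_uniq (p : CR) h l l' : chord_lift E T p h l ->
  chord_lift E T p h l' -> forall t, 0 <= t <= T -> l t = l' t.
Proof.
move=> [cl l0 lE] [cl' l'0 l'E] t /andP[t0 tT].
suff : l t - l' t = l 0 - l' 0 by rewrite l0 l'0; lra.
apply: (@int_valued_cst R (fun u => l u - l' u) t t0).
  by move=> u; apply: cvgB; [exact: cl|exact: cl'].
by move=> u ui; apply/turn_eq; rewrite lE ?l'E//; lra.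
Qed.

Lemma dot_scale_gt0 (h x y : R) (w : tangent R) : 0 < h ->
  0 < dot (x, y) w -> 0 < dot (h * x, h * y) w.
Proof. by move=> h0; rewrite /dot /= -!mulrA -mulrDr pmulr_rgt0. Qed.

Let cfst : continuous (fst : CR -> circle R).
Proof. by move=> z; exact: cvg_fst. Qed.

Let csnd : continuous (snd : CR -> R).
Proof. by move=> z; exact: cvg_snd. Qed.

Section Vertical.
Variables (a : circle R) (b : R).

Let hshift (t y : R) := circle_log ((E t (a, b + y)).1 - (E t (a, b)).1).
Let vtangent (t y : R) : R * R := annulus_diff (E t) (a, b + y) chi.

Let vertical_continuous : continuous (fun z : R * R => (z.1, (a, b + z.2))).
Proof.
apply: continuous_pair; first by move=> z; exact: cvg_fst.
apply: continuous_pair; first exact: cst_continuous.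
by move=> z; apply: cvgD; [exact: cvg_cst|exact: cvg_snd].
Qed.

Let cE1 : continuous (fun z : R * R => (E z.1 (a, b + z.2)).1).
Proof.
exact: (continuous_compT (continuous_compT vertical_continuous
  (family_continuous hE)) cfst).
Qed.

Let cvtangent : continuous (fun z : R * R => vtangent z.1 z.2).
Proof.
have c := continuous_compT vertical_continuous (family_diff_continuous hE (xi
  := chi)).
rewrite /vtangent. exact: c.
Qed.

Let cbase : continuous (fun t => (E t (a, b)).1).
Proof.
have c0 : continuous (fun t : R => (t, 0 : R)).
  by apply: continuous_pair; [move=> t; exact: cvg_id|exact: cst_continuous].
have := continuous_compT c0 cE1; rewrite [X in continuous X](_ : _ = fun t =>
  (E t (a, b)).1)//.
by apply/funext => t /=; rewrite addr0.
Qed.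

Lemma hshift_continuous (z : R * R) : `|hshift z.1 z.2| < 4^-1 ->
  {for z, continuous (fun z => hshift z.1 z.2)}.
Proof.
move=> kz.
have cd : continuous (fun z : R * R => (E z.1 (a, b + z.2)).1 - (E z.1 (a,
  b)).1).
  move=> y; apply: cvg_circleB; first exact: cE1.
  by apply: (continuous_compT (f := fst)) cbase y => y; exact: cvg_fst.
apply: (@continuous_comp _ _ _ (fun z : R * R => (E z.1 (a, b + z.2)).1 - (E
  z.1 (a, b)).1)).
  exact: cd.
by apply: circle_log_continuous; move: kz; rewrite ltr_norml /hshift; lra.
Qed.

Let hshift0 t : hshift t 0 = 0.
Proof. by rewrite /hshift addr0 subrr circle_log0. Qed.

(** The displacement vanishes at y = 0, and compactness of [0, T] makes the bound uniform in
    time. *)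
Lemma hshift_small : exists2 e : R, 0 < e & forall y t : R,
  `|y| < e -> 0 <= t <= T -> `|hshift t y| < 4^-1.
Proof.
have /compact_near_coveringP cpt := @segment_compact R 0 T.
have := cpt R (nbhs (0 : R)) (fun y t => `|hshift t y| < 4^-1) _.
case=> [t _|e e0 eP].
  have k0 : `|hshift t 0| < 4^-1 by rewrite hshift0 normr0; lra.
  have : \forall z \near ((t, 0) : R * R), `|hshift z.1 z.2| < 4^-1.
    by apply: cvgr_norm_lt (@hshift_continuous (t, 0) k0) _ _.
  by case=> [[U V] [/= nU nV] UV]; exists (U, V).
exists e => // y t ye ti; apply: eP; last by rewrite /= in_itv.
by rewrite /ball_ /= sub0r normrN.
Qed.

(** Two independent heights appear because the mean value theorem is to be applied to each
    coordinate separately. At y = z = 0 the product is the squared norm of a non-zero vector, and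
    compactness of [0, T] gives a radius uniform in time. *)
Lemma vtangent_dot_gt0 : exists2 e : R, 0 < e & forall y z t : R,
  `|y| < e -> `|z| < e -> 0 <= t <= T ->
  0 < dot ((vtangent t y).1, (vtangent t z).2) (vtangent t 0).
Proof.
have /compact_near_coveringP cpt := @segment_compact R 0 T.
have := cpt (R * R)%type (nbhs ((0, 0) : R * R))
  (fun yz t => 0 < dot ((vtangent t yz.1).1, (vtangent t yz.2).2) (vtangent t
    0)) _.
pose S (z : R * (R * R)) : R :=
  dot ((vtangent z.1 z.2.1).1, (vtangent z.1 z.2.2).2) (vtangent z.1 0).
have cS : continuous S.
  have cf : continuous (fst : R * R -> R) by move=> z; exact: cvg_fst.
  have cs : continuous (snd : R * R -> R) by move=> z; exact: cvg_snd.
  have cs' : continuous (snd : R * (R * R) -> R * R) by move=> z;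
    exact: cvg_snd.
  have cf' : continuous (fst : R * (R * R) -> R) by move=> z; exact: cvg_fst.
  have c1 := continuous_compT (continuous_pair cf' (continuous_compT cs' cf))
    cvtangent.
  have c2 := continuous_compT (continuous_pair cf' (continuous_compT cs' cs))
    cvtangent.
  have c0 := continuous_compT (continuous_pair cf'
    (@cst_continuous (R * (R * R))%type R 0)) cvtangent.
  move=> z; apply: cvgD; apply: cvgM.
  - exact: (continuous_compT c1 cf).
  - exact: (continuous_compT c0 cf).
  - exact: (continuous_compT c2 cs).
  - exact: (continuous_compT c0 cs).
case=> [t _|[U V] [/= nU nV] UV].
  have S0 : 0 < S (t, (0, 0)).
    have [_ Cd _] := hE.
    have : vtangent t 0 != 0.
      by rewrite /vtangent annulus_diff_eq0//; apply/eqP => -[/eqP];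
        rewrite oner_eq0.
    rewrite /S /dot /=; case: (vtangent t 0) => u v /= uv0.
    rewrite -!expr2 lt0r addr_ge0 ?sqr_ge0// andbT.
    apply: contra uv0; rewrite paddr_eq0 ?sqr_ge0// !sqrf_eq0.
    by case/andP => /eqP -> /eqP ->.
  have : \forall z \near ((t, (0, 0)) : R * (R * R)), 0 < S z.
    by apply: cvgr_gt (cS (t, (0, 0))) _ _.
  by case=> [[U V] [/= nU nV] UV]; exists (U, V).
have [e e0 eUV] : exists2 e : R, 0 < e & ball (0 : R) e `<=` U `&` V.
  have nUV : nbhs (0 : R) (U `&` V) by exact: filterI.
  by move/nbhs_ballP: nUV => [e /= e0 eUV]; exists e.
exists e => // y z t ye ze ti.
have [Uy _] : (U `&` V) y by apply: eUV; rewrite /ball /= sub0r normrN.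
have [_ Vz] : (U `&` V) z by apply: eUV; rewrite /ball /= sub0r normrN.
by apply: (UV (y, z)) => //; rewrite /= in_itv.
Qed.

Lemma hshift_derive (e t y : R) : (forall z, `|z| < e -> `|hshift t z| < 4^-1)
  ->
  `|y| < e -> is_derive y 1 (hshift t) (vtangent t y).1.
Proof.
move=> small ye; apply: is_derive_cvg.
have [+ _] := vertical_quotient a (b + y) (family_diffable hE t).
apply: cvg_trans; apply: near_eq_cvg.
have n1 : \forall k \near (0 : R)^', `|y + k| < e.
  apply: nbhs_dnbhs.
  have cyk : y + k @[k --> (0 : R)] --> y + 0.
    by apply: cvgD; [exact: cvg_cst|exact: cvg_id].
  by apply: cvgr_norm_lt cyk _ _; rewrite addr0.
pose M k := circle_log ((E t (a, b + y + k)).1 - (E t (a, b + y)).1).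
have n2 : \forall k \near (0 : R)^', `|M k| < 4^-1.
  apply: nbhs_dnbhs.
  have cM : M k @[k --> (0 : R)] --> (0 : R).
    rewrite -[X in _ --> X]circle_log0 -(subrr (E t (a, b + y)).1).
    apply: (@continuous_cvg _ _ _ _ _ _ (@circle_log R)).
      by apply: circle_log_continuous; rewrite subrr circle_log0; lra.
    apply: cvg_circleB; last exact: cvg_cst.
    have cc : continuous (fun k : R => (t, y + k)).
      apply: continuous_pair; first exact: cst_continuous.
      by move=> k; apply: cvgD; [exact: cvg_cst|exact: cvg_id].
    have /(_ (0 : R)) := continuous_compT cc cE1.
    rewrite /continuous_at /= addr0.
    by under eq_cvg => k do rewrite addrA.
  by apply: cvgr_norm_lt cM _ _; rewrite normr0; lra.
near=> k; congr (_ * _).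
have k1 : `|y + k| < e by near: k.
have k2 : `|M k| < 4^-1 by near: k.
have ky := small _ ye; have kyk := small _ k1.
(* The increment of [hshift] and the logarithm [M k] of the increment based at height b + y agree
   modulo 1. The three terms are below 1/4 in absolute value, so the integer is 0. *)
suff : hshift t (y + k) - hshift t y - M k = 0 by rewrite /M; lra.
apply: int_small; last by move: k2 ky kyk; rewrite !ltr_norml; lra.
have /turn_eq : turn (hshift t (y + k) - hshift t y - M k) = turn 0.
  rewrite turnB (turnB (hshift t (y + k))) /hshift /M !circle_logK turn0 [b +
    (y + k)]addrA.
  by rewrite opprB addrA subrK subrr.
by rewrite subr0.
Unshelve. all: by end_near. Qed.

Lemma height_derive (t y : R) : is_derive y 1 (fun y => (E t (a, b + y)).2)
  (vtangent t y).2.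
Proof.
apply: is_derive_cvg.
have [_] := vertical_quotient a (b + y) (family_diffable hE t).
by under eq_cvg => k do rewrite -addrA.
Qed.

(* By the mean value theorem the chord to the point at height [h] is [h] times
   a vector whose two coordinates are coordinates of [D(E t) chi] at two points
     of
   the vertical segment. *)
Lemma chord_tangent : exists2 h, 0 < h & forall l,
  chord_lift E T (a, b) h l -> forall t, 0 <= t <= T ->
  0 < dot (chord E (a, b) h l t) (annulus_diff (E t) (a, b) chi).
Proof.
have [e1 e1_gt0 small] := hshift_small; have [e2 e2_gt0 pos] :=
  vtangent_dot_gt0.
pose h := Num.min e1 e2 / 2.
have m_gt0 : 0 < Num.min e1 e2 by rewrite lt_min e1_gt0.
have h_gt0 : 0 < h by rewrite divr_gt0.
have he1 : h < e1.
  by have : Num.min e1 e2 <= e1 by [rewrite ge_min lexx]; rewrite /h; lra.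
have he2 : h < e2.
  by have : Num.min e1 e2 <= e2 by [rewrite ge_min lexx orbT]; rewrite /h; lra.
exists h => // l ll t ti; have /andP[t0 tT] := ti.
have [cl l0 lE] := ll.
have hn : `|h| < e1 by rewrite gtr0_norm.
(* Both sides lift the same displacement and vanish at time 0. [hshift] is continuous in time
   because it stays away from the cut of [circle_log]. *)
have lshift_eq : l t = hshift t h.
  suff : l t - hshift t h = 0 by lra.
  pose D u := l (clamp T u) - hshift (clamp T u) h.
  have : D t = D 0.
    apply: (@int_valued_cst R D t t0).
      move=> u; have ci := clamp_itv u T0.
      apply: cvgB; first exact: (continuous_compT (@clamp_continuous R T) cl).
      have cc : continuous (fun u : R => (clamp T u, h)).
        by apply: continuous_pair; [exact: clamp_continuous|exact:
          cst_continuous].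
      apply: (@continuous_comp _ _ _ (fun u : R => (clamp T u, h)) (fun z =>
        hshift z.1 z.2)).
        exact: cc.
      by apply: hshift_continuous; exact: small.
    move=> u ui; have ci := clamp_itv u T0.
    by apply/turn_eq; rewrite lE// /hshift circle_logK.
  rewrite /D !clamp_id ?lexx// => ->.
  have [E0 _ _] := hE.
  by rewrite l0 /hshift E0 /= subrr circle_log0 subr0.
have dhshift (y : R) : `|y| < e1 -> is_derive y 1 (hshift t) (vtangent t y).1.
  by apply: hshift_derive => z ze; exact: small.
have abs_itv (y : R) : 0 <= y <= h -> `|y| < e1 /\ `|y| < e2.
  by move=> /andP[y0 yh]; rewrite ger0_norm//; split; lra.
have [y1 y1i e1E] : exists2 y, 0 <= y <= h & hshift t h = h * (vtangent t y).1.
  have [|| y yi yE] := @MVT R (hshift t) (fun y => (vtangent t y).1) 0 h h_gt0.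
  - move=> y; rewrite in_itv /= => yi; apply: dhshift.
    by have [] := abs_itv y ltac:(lra).
  - apply: derivable_within_continuous => y; rewrite in_itv /= => yi.
    by have [] := dhshift y (abs_itv y yi).1.
  - exists y; first by move: yi; rewrite in_itv /=; lra.
    by move: yE; rewrite hshift0 !subr0 mulrC.
have [y2 y2i e2E] : exists2 y, 0 <= y <= h &
    (E t (a, b + h)).2 - (E t (a, b)).2 = h * (vtangent t y).2.
  have [|| y yi yE] := @MVT R (fun y => (E t (a, b + y)).2) (fun y => (vtangent
    t y).2) 0 h h_gt0.
  - by move=> y _; exact: height_derive.
  - by apply: derivable_within_continuous => y _; have [] := height_derive t y.
  - exists y; first by move: yi; rewrite in_itv /= => /andP[y0 yh];
    rewrite !ltW.
    by move: yE; rewrite subr0 mulrC (_ : b + 0 = b)//; exact: addr0.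
rewrite /chord lshift_eq e1E /= e2E.
have b0 : b + 0 = b by exact: addr0.
have p0E : vtangent t 0 = annulus_diff (E t) (a, b) chi by rewrite /vtangent b0.
have [_ y1e] := abs_itv _ y1i; have [_ y2e] := abs_itv _ y2i.
rewrite -p0E; have := pos y1 y2 t y1e y2e ti.
exact: dot_scale_gt0.
Qed.

End Vertical.

End Crossing.

(** * Angle variation at a lowest point of a graph *)

Section Lowest.
Context {R : realType}.
Local Notation A := (annulus R).
Local Notation CR := (circle R * R)%type.

Lemma C1_map_continuous (f : A -> A) : C1_map f -> continuous (f : CR -> CR).
Proof.
move=> [_ cf].
have c0 : continuous (fun x : CR => (x, (0 : R * R))).
  by apply: continuous_pair; [move=> x; exact: cvg_id|exact: cst_continuous].
have c1 := continuous_compT c0 cf.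
by apply: (continuous_compT c1 (g := fst)) => z; exact: cvg_fst.
Qed.

Lemma chi_neq0 : (chi : tangent R) != 0.
Proof. by apply/eqP => -[/eqP]; rewrite oner_eq0. Qed.

Lemma lifts_ext (u u' : R -> tangent R) T v :
  (forall t, 0 <= t <= T -> u t = u' t) -> lifts u T v -> lifts u' T v.
Proof. by move=> uu' [cv vE]; split=> // t ti; rewrite -uu'// vE. Qed.

Lemma lifts_shift (u : R -> tangent R) T v (n : R) : n \is a Num.int ->
  lifts u T v -> lifts u T (fun t => v t - n).
Proof.
move=> ni [cv vE]; split; first by move=> t; apply: cvgB;
  [exact: cv|exact: cvg_cst].
move=> t ti; rewrite -vE//; apply/turn_eq.
by rewrite addrAC subrr add0r rpredN.
Qed.

Variables (E : R -> A -> A) (T : R) (phi : circle R -> R) (s0 : R).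
Hypothesis hE : smooth_family E.
Hypothesis T0 : 0 <= T.
Hypothesis cphi : continuous phi.
Let p0 : CR := (turn s0, phi (turn s0)).
Hypothesis lowest : forall a, (E T p0).2 <= (E T (a, phi a)).2.

(* If the image of the region below the graph were above the lowest point,
   the two detours would turn a downward chord by +1/2 and by -1/2. *)
Lemma upper_region x : phi x.1 <= x.2 -> (E T p0).2 <= (E T x).2.
Proof.
have [_ Cd _] := hE; have [_ [g' [Cg' gg' g'g]]] := Cd T.
have cg' := C1_map_continuous Cg'.
have [up|down] := separation cg' gg' g'g cphi lowest; first exact: up.
have chord_down (d : R) : d = 1 \/ d = -1 -> exists l b,
    [/\ chord_lift E T p0 (-1) l, lifts (chord E p0 (-1) l) T b,
    b 0 = - d / 2 & `|b T| <= 4^-1].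
  move=> d1; have [||l [b [ll lb b0 bT]]] := chord_turn hE T0 cphi d1 (s0 :=
    s0) (h := -1).
  - by rewrite oppr_eq0 oner_eq0.
  - by move=> s /andP[s0_ge0 _]; apply: down; rewrite /= mulrN1 gerDl oppr_le0.
  - by exists l, b; split=> //; rewrite b0 ltr0N1.
have [l1 [b1 [ll1 lb1 b10 b1T]]] := chord_down 1 (or_introl erefl).
have [l2 [b2 [ll2 lb2 b20 b2T]]] := chord_down (-1) (or_intror erefl).
have lb2' : lifts (chord E p0 (-1) l1) T b2.
  apply: lifts_ext lb2 => t ti; rewrite /chord.
  by rewrite (chord_lift_uniq ll1 ll2).
have := lifts_uniq T0 lb1 lb2'; rewrite b10 b20.
by move: b1T b2T; rewrite !ler_norml; lra.
Qed.

(** The chord turns by at most 1/4, and the tangent vector stays within a quarter turn of it because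
    their dot product remains positive. This positivity makes the second bound strict. *)
Lemma lowest_turn (v : R -> R) :
  lifts (fun t => annulus_diff (E t) p0 chi) T v -> `|v T - v 0| < 2^-1.
Proof.
move=> lv; have [E0 Cd _] := hE.
have [h h_gt0 dotp] := chord_tangent hE T0 (turn s0) (phi (turn s0)).
have [||l [b [ll lb b0 bT]]] := chord_turn hE T0 cphi (or_introl erefl) (s0 :=
  s0) (h := h).
- by rewrite gt_eqF.
- move=> s /andP[s0_ge0 _]; apply: upper_region.
  by rewrite /= lerDl mulr_ge0// ltW.
rewrite h_gt0 in b0.
have i0 : 0 <= (0 : R) <= T by rewrite lexx.
(* The vector starts at [chi], so subtracting [v 0] gives another lift, which starts at 0 as [b]
   does. *)
have v0 : v 0 \is a Num.int.
  have : turn (v 0) = turn 0.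
    have [_ ->//] := lv; rewrite E0 annulus_diff_id; last first.
      by have [[]] := Cd 0; rewrite E0.
    by have := theta_vertical (oner_neq0 R); rewrite ltr01.
  by move/turn_eq; rewrite subr0.
have lv' := lifts_shift v0 lv.
pose c t := (v t - v 0) - b t.
have cosc t : 0 <= t <= T -> 0 < cos (2 * pi * c t).
  move=> ti; have d0 := dotp l ll t ti.
  have w0 : annulus_diff (E t) p0 chi != 0 by rewrite annulus_diff_eq0//
    chi_neq0.
  have u0 : chord E p0 h l t != 0.
    by apply: contraTneq d0 => ->; rewrite /dot /= !mul0r addr0 ltxx.
  have [_ lbE] := lb; have [_ lvE] := lv'.
  have [r r0 rE] := dot_polar u0 w0 (lbE t ti) (lvE t ti).
  by rewrite -(pmulr_rgt0 _ r0) -rE.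
have cT : `|c T| <= 4^-1.
  apply: (half_plane_stable T0 (b := c)).
  - have [cb _] := lb; have [cv _] := lv'.
    by move=> t; apply: cvgB; [exact: cv|exact: cb].
  - by move=> t ti; apply/ltW/cosc.
  - by rewrite /c b0 subrr subr0 normr0; lra.
have cT_neq : `|c T| != 4^-1.
  apply/eqP => cTE; have : cos (2 * pi * `|c T|) = 0.
    rewrite cTE (_ : 2 * pi * 4^-1 = pi / 2) ?cos_pihalf//.
    by field.
  have -> : cos (2 * pi * `|c T|) = cos (2 * pi * c T).
    by have [_|_] := ger0P (c T) => //; rewrite mulrN cosN.
  by move/eqP; rewrite gt_eqF// cosc// lexx T0.
have : `|c T| < 4^-1 by rewrite lt_neqAle cT_neq.
by move: bT; rewrite ler_norml !ltr_norml /c; lra.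
Qed.

End Lowest.

(** * Angle variation of the vertical vector *)

Section Turning.
Context {R : realType}.
Local Notation A := (annulus R).
Local Notation CR := (circle R * R)%type.

Definition chi_field (E : R -> A -> A) (x : CR) (t : R) : R * R :=
  annulus_diff (E t) x chi.

Section OneFamily.
Variables (E : R -> A -> A) (T : R).
Hypothesis hE : smooth_family E.
Hypothesis T0 : 0 <= T.

Lemma chi_field0 x : chi_field E x 0 = chi.
Proof.
have [E0 Cd _] := hE; rewrite /chi_field E0 annulus_diff_id//.
by have [[]] := Cd 0; rewrite E0.
Qed.

Lemma chi_field_neq0 x t : chi_field E x t != 0.
Proof. by have [_ Cd _] := hE; rewrite /chi_field annulus_diff_eq0// chi_neq0.
  Qed.

Lemma theta_chi : theta chi (chi : tangent R) = turn 0.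
Proof. by have := theta_vertical (oner_neq0 R); rewrite ltr01. Qed.

(** The angle is lifted over the whole square of (s, t) at once; the variation along the path is
    then the difference of two sides of the lift. *)
Lemma turning_continuous (x : R -> CR) : continuous x ->
  exists2 D : R -> R, continuous D & forall s, 0 <= s <= 1 ->
  exists2 v, lifts (chi_field E (x s)) T v & D s = v T - v 0.
Proof.
move=> cx.
have cf : continuous (fun p : R * R => chi_field E (x p.1) p.2).
  have c1 : continuous (fun p : R * R => (p.2, x p.1)).
    apply: continuous_pair; first by move=> p; exact: cvg_snd.
    by apply: (continuous_compT (f := fst)) cx => p; exact: cvg_fst.
  exact: (continuous_compT c1 (family_diff_continuous hE (xi := chi))).
have [||L [cL _ LE]] := @square_lift R
    (fun p => theta chi (chi_field E (x p.1) p.2)) T T0 _ 0.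
- move=> s t _ _; apply: (@continuous_comp _ _ _
    (fun p : R * R => chi_field E (x p.1) p.2)); first exact: cf.
  by apply: theta_continuous; exact: chi_field_neq0.
- by rewrite /= chi_field0 theta_chi.
have cLs t : continuous (fun s => L (s, t)).
  apply: (continuous_compT _ cL); apply: continuous_pair.
    by move=> ?; exact: cvg_id.
  exact: cst_continuous.
have cLt s : continuous (fun t => L (s, t)).
  apply: (continuous_compT _ cL); apply: continuous_pair.
    exact: cst_continuous.
  by move=> ?; exact: cvg_id.
exists (fun s => L (s, T) - L (s, 0)).
  by move=> s; apply: cvgB; exact: cLs.
move=> s si; exists (fun t => L (s, t)) => //; split; first exact: cLt.
by move=> t ti; rewrite LE.
Qed.

End OneFamily.

Lemma segment_argmin (h : circle R -> R) : continuous h ->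
  exists2 s, 0 <= s <= 1 & forall a, h (turn s) <= h a.
Proof.
move=> ch; have cht := continuous_compT (@turn_continuous R) ch.
have [|s si smin] := @EVT_min R (fun u => h (turn u)) 0 1 ler01.
  exact: continuous_subspaceT.
exists s; first by move: si; rewrite in_itv.
move=> a; have /andP[a0 a1] := circle_log_itv a.
have [al|al] := leP 0 (circle_log a).
  have := smin (circle_log a); rewrite circle_logK; apply.
  by rewrite in_itv /=; lra.
have := smin (circle_log a + 1).
rewrite (_ : turn (circle_log a + 1) = a); last first.
  rewrite -[RHS]circle_logK; apply/turn_eq.
  by rewrite addrAC subrr add0r rpred1.
by apply; rewrite in_itv /=; lra.
Qed.

Lemma turning_unique (E E' : R -> A -> A) (T : R) (x : CR) v v' :
  smooth_family E -> smooth_family E' -> 0 <= T -> E T = E' T ->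
  lifts (chi_field E x) T v -> lifts (chi_field E' x) T v' ->
  v T - v 0 = v' T - v' 0.
Proof.
move=> hE hE' T0 EE' lv lv'.
(* The circle at height 0 serves as an auxiliary graph. Since [E T = E' T], the same point of it has
   the lowest image for both families. *)
pose phi (_ : circle R) : R := 0.
have cphi : continuous phi by exact: cst_continuous.
have [|s0 _ s0min] := @segment_argmin (fun a => (E T (a, 0)).2).
  have c1 : continuous (fun a : circle R => (T, (a, 0 : R))).
    apply: continuous_pair; first exact: cst_continuous.
    by apply: continuous_pair; [move=> a; exact: cvg_id|exact: cst_continuous].
  have c2 := continuous_compT c1 (family_continuous hE).
  by apply: (continuous_compT c2 (g := snd)) => z; exact: cvg_snd.
have s0min' a : (E' T (turn s0, 0)).2 <= (E' T (a, 0)).2 by rewrite -EE'.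
pose s1 := circle_log x.1.
(* A straight path in the universal cover from [x] to that point. The difference of the two
   variations is an integer, hence constant along it. *)
pose y (s : R) : CR := (turn (s1 + s * (s0 - s1)), x.2 + s * (0 - x.2)).
have cy : continuous y.
  apply: continuous_pair.
    apply: (continuous_compT (g := @turn R)); last exact: turn_continuous.
    by move=> u; apply: cvgD; [exact: cvg_cst|apply: cvgM;
      [exact: cvg_id|exact: cvg_cst]].
  by move=> u; apply: cvgD; [exact: cvg_cst|apply: cvgM;
    [exact: cvg_id|exact: cvg_cst]].
have y0 : y 0 = x.
  by rewrite /y !mul0r !addr0 circle_logK -surjective_pairing.
have y1 : y 1 = (turn s0, 0) by rewrite /y !mul1r !subrKC.
have [D cD DE] := turning_continuous hE T0 cy.
have [D' cD' D'E] := turning_continuous hE' T0 cy.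
have i0 : 0 <= (0 : R) <= 1 by rewrite lexx ler01.
have i1 : 0 <= (1 : R) <= 1 by rewrite lexx ler01.
have iT : 0 <= T <= T by rewrite lexx T0.
have iT0 : 0 <= (0 : R) <= T by rewrite lexx T0.
have Dint s : 0 <= s <= 1 -> D s - D' s \is a Num.int.
  move=> si; have [w [_ wE] ->] := DE s si; have [w' [_ w'E] ->] := D'E s si.
  have /turn_eq h1 : turn (w T) = turn (w' T) by rewrite (wE _ iT) (w'E _ iT)
    /chi_field EE'.
  have /turn_eq h2 : turn (w 0) = turn (w' 0).
    by rewrite (wE _ iT0) (w'E _ iT0) (chi_field0 hE) (chi_field0 hE').
  rewrite (_ : _ - _ = (w T - w' T) - (w 0 - w' 0)); last by ring.
  exact: rpredB.
have D1 : D 1 - D' 1 = 0.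
  apply: int_small; first exact: Dint.
  have [w lw ->] := DE 1 i1; have [w' lw' ->] := D'E 1 i1.
  rewrite y1 in lw lw'.
  have := lowest_turn hE T0 cphi s0min lw.
  have := lowest_turn hE' T0 cphi s0min' lw'.
  by rewrite !ltr_norml; lra.
have D0 : D 0 = D' 0.
  suff : D 1 - D' 1 = D 0 - D' 0 by rewrite D1; lra.
  apply: (@int_valued_cst R (fun s => D s - D' s) 1 ler01) => //.
  by move=> s; apply: cvgB; [exact: cD|exact: cD'].
have [w lw Dw] := DE 0 i0; have [w' lw' Dw'] := D'E 0 i0.
rewrite y0 in lw lw'.
by rewrite (lifts_uniq T0 lv lw) (lifts_uniq T0 lv' lw') -Dw -Dw'.
Qed.

Definition turning (E : R -> A -> A) (T : R) (x : CR) : R :=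
  xget 0 [set d | exists2 v, lifts (chi_field E x) T v & d = v T - v 0].

Lemma turningE E T x v : 0 <= T -> lifts (chi_field E x) T v ->
  turning E T x = v T - v 0.
Proof.
move=> T0 lv; rewrite /turning; case: xgetP => [d _ [w lw ->]|].
  exact: lifts_uniq lw lv.
by move=> /(_ (v T - v 0)) /= []; exists v.
Qed.

Lemma turning_lift E T x : smooth_family E -> 0 <= T ->
  exists v, [/\ lifts (chi_field E x) T v, v 0 = 0 & turning E T x = v T].
Proof.
move=> hE T0.
have [|||v lv v0] := @lifts_exist R (chi_field E x) T 0 T0.
- have c1 : continuous (fun t : R => (t, x)).
    by apply: continuous_pair; [move=> t; exact: cvg_id|exact: cst_continuous].
  exact: (continuous_compT c1 (family_diff_continuous hE (xi := chi))).
- by move=> t _; exact: chi_field_neq0.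
- by rewrite chi_field0// theta_chi.
by exists v; split => //; rewrite (turningE T0 lv) v0 subr0.
Qed.

End Turning.

(** * Iteration of the isotopy *)

Section Extension.
Context {R : realType}.
Local Notation A := (annulus R).
Local Notation CR := (circle R * R)%type.
Local Notation TA := ((circle R * R) * (R * R))%type.
Variables (F : R -> A -> A) (f : A -> A).
Hypothesis hF : isotopy_from_id F f.

(* On [0, n] this is the extended isotopy;
  clamping the time of each factor makes
   the family continuous in t with no gluing at the integers. *)
Fixpoint ext (n : nat) (t : R) : A -> A :=
  if n is m.+1 then F (clamp 1 (t - m%:R)) \o ext m t else id.

Let clampi (t : R) : clamp 1 t \in `[0, 1].
Proof. by rewrite in_itv /= clamp_itv. Qed.

Lemma ext_smooth n : smooth_family (ext n).
Proof.
have [iF F0 _] := hF; have [CF _] := iF.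
have Cid : C1_diffeo (@id A).
  by have := CF 0; rewrite F0; apply; rewrite in_itv /= lexx ler01.
elim: n => [|n [E0 CE cE]].
  split => //; have [[did _] _] := Cid.
  rewrite (_ : (fun q : R * TA => _) = snd).
    by move=> q; exact: cvg_snd.
  by apply/funext => -[t [x h]]; rewrite /tangent_map /= annulus_diff_id.
split.
- by rewrite /= E0 clamp_le0 ?F0// sub0r oppr_le0.
- by move=> t /=; apply: C1_diffeo_comp => //; exact: CF.
have cF := isotopy_continuous iF.
have c1 : continuous (fun q : R * TA => (q.1 - n%:R, tangent_map (ext n q.1)
  q.2 : TA)).
  apply: continuous_pair; last exact: cE.
  by move=> q; apply: cvgB; [exact: cvg_fst|exact: cvg_cst].
have extS : (fun q : R * TA => tangent_map (ext n.+1 q.1) q.2 : TA) =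
    (fun q => tangent_map (F (clamp 1 (q.1 - n%:R))) (tangent_map (ext n q.1)
      q.2)).
  apply/funext => -[t x].
  have [[dE _] _] := CE t; have [[dF _] _] := CF _ (clampi (t - n%:R)).
  by rewrite [LHS]/= (tangent_map_comp dE dF).
by rewrite extS; exact: (continuous_compT c1 cF).
Qed.

Lemma ext_ge n t : n%:R <= t -> ext n t = iter n f.
Proof.
have [_ _ F1] := hF.
elim: n => // n IH nt; rewrite /= IH; last by rewrite (le_trans _ nt)// ler_nat.
rewrite clamp_ge ?F1//.
by rewrite ler01 /= lerBrDr addrC natr1.
Qed.

Lemma ext_le m n t : (m <= n)%N -> t <= m%:R -> ext n t = ext m t.
Proof.
have [_ F0 _] := hF.
move=> mn tm; elim: n mn => [|n IH]; first by rewrite leqn0 => /eqP ->.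
rewrite leq_eqVlt => /orP[/eqP ->//|]; rewrite ltnS => mn /=.
rewrite IH// clamp_le0 ?F0//.
by rewrite subr_le0 (le_trans tm)// ler_nat.
Qed.

Lemma ext_extended n t : 0 <= t <= n%:R -> ext n t = extended_isotopy F t.
Proof.
move=> /andP[t0 tn]; have [_ F0 F1] := hF.
have /andP[kt tk] := truncn_itv t0.
rewrite /extended_isotopy F1; set k := Num.truncn t in kt tk *.
have kn : (k <= n)%N by rewrite -(ler_nat R) (le_trans kt).
(* If the truncation of t is n, then t = n: the extended isotopy has just started its next factor,
   at [F 0 = id], which [ext n] does not contain. *)
move: kn; rewrite leq_eqVlt => /orP[/eqP kn|kn].
  have tE : t = k%:R by apply/eqP; rewrite eq_le kt kn tn.
  by rewrite ext_ge -?kn// tE subrr F0; apply/funext => x.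
rewrite (ext_le kn); last exact: ltW.
rewrite /= ext_ge// clamp_id// subr_ge0 kt /= lerBlDr addrC natr1.
exact: ltW.
Qed.

Lemma ext_diffeo n : C1_diffeo (iter n f).
Proof. by have [_ /(_ n%:R) + _] := ext_smooth n; rewrite ext_ge. Qed.

(** During the last unit of time the image of [chi] is moved by the isotopy started at [iter n f x].
    There [lifts_le] compares it with the image of the vertical vector, whose angle goes from 0 to a
    negative value. So an upper bound by a multiple of 1/2 persists and becomes strict. *)
Lemma turning_step n (x : CR) (k : int) :
  turning (ext 1) 1 (iter n f x) < 0 ->
  turning (ext n) n%:R x <= k%:~R / 2 ->
  turning (ext n.+1) n.+1%:R x < k%:~R / 2.
Proof.
move=> neg; have n0 : 0 <= n%:R :> R by rewrite ler0n.
have [w [lw w0 ->]] := turning_lift x (ext_smooth n.+1) (ler0n _ n.+1).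
have [cw wE] := lw.
have lwn : lifts (chi_field (ext n) x) n%:R w.
  split=> // t /andP[t0 tn]; rewrite wE;
    last by rewrite t0 (le_trans tn)// ler_nat.
  by rewrite /chi_field (ext_le (leqnSn n)).
rewrite (turningE n0 lwn) w0 subr0.
have [b [lb b0 bE]] := turning_lift (iter n f x) (ext_smooth 1) (@ler01 R).
rewrite bE in neg.
pose u (t : R) : tangent R :=
  annulus_diff (ext 1 t) (iter n f x) (annulus_diff (iter n f) x chi).
have [_ C1 _] := ext_smooth 1; have Cn := ext_diffeo n.
have lu : lifts u 1 (fun t => w (n%:R + t)).
  split.
    apply: continuous_compT cw => t.
    by apply: cvgD; [exact: cvg_cst|exact: cvg_id].
  move=> t /andP[t0 t1].
  have -> : turn (w (n%:R + t)) = theta chi (chi_field (ext n.+1) x (n%:R + t)).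
    by rewrite wE// addr_ge0//= -natr1 lerD2l.
  have extE : ext n.+1 (n%:R + t) = ext 1 t \o iter n f.
    by rewrite /= ext_ge ?lerDl// subr0 addrAC subrr add0r.
  have [[df _] _] := Cn; have [[d1 _] _] := C1 t.
  by rewrite /chi_field extE (annulus_diff_comp _ df d1).
have H := @lifts_le R u (chi_field (ext 1) (iter n f x)) 1 _ b k ler01 lu lb.
rewrite /= addr0 b0 subr0 natr1 in H => wn.
suff : w n.+1%:R - b 1 <= k%:~R / 2 by lra.
apply: (H _ _ wn) => t _.
  split; last exact: (chi_field_neq0 (ext_smooth 1)).
  exact: (annulus_diff_neq0 _ (C1 t) (annulus_diff_neq0 _ Cn chi_neq0)).
apply: (etrans (cross_annulus_diff _ _ _ (C1 t))).
exact: (esym (cross_annulus_diff _ _ _ (C1 0))).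
Qed.

End Extension.

(** * Points of zero torsion *)

Section ZeroTorsion.
Context {R : realType}.
Local Notation A := (annulus R).
Local Notation CR := (circle R * R)%type.

(** The preimage of a closed set under [phi] is the projection of a closed, hence compact, set of
    parameters of the curve. It is closed because the circle is Hausdorff. *)
Lemma graph_continuous (gamma : circle R -> annulus R) (phi : circle R -> R) :
  continuous gamma -> range gamma = graph phi -> continuous phi.
Proof.
move=> cgamma gphi; apply/continuous_closedP => B cB.
have cfst : continuous (fst : CR -> circle R) by move=> z; exact: cvg_fst.
have csnd : continuous (snd : CR -> R) by move=> z; exact: cvg_snd.
have cg1 : continuous (fun s => (gamma s).1) by exact: (continuous_compT cgamma
  cfst).
have cg2 : continuous (fun s => (gamma s).2) by exact: (continuous_compT cgamma
  csnd).
have -> : phi @^-1` B = (fun s => (gamma s).1) @` ((fun s => (gamma s).2) @^-1`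
  B).
  apply/seteqP; split=> a /=.
    move=> Ba; have : range gamma (a, phi a) by rewrite gphi.
    by move=> [s _ sE]; exists s; rewrite sE.
  move=> [s Bs <-]; have : graph phi (gamma s) by rewrite -gphi; exists s.
  by rewrite /graph /= => <-.
apply: compact_closed; first exact: circle_hausdorff.
apply: continuous_compact; first exact: continuous_subspaceT.
apply: (subclosed_compact _ circle_compact) => //.
by move/continuous_closedP: cg2; exact.
Qed.

(** Choose [u n] in the set of index n. A cluster point of [u] lies in all the sets: if the
    inequality failed at index m, it would fail near the cluster point, in particular at some [u n]
    with n >= m. *)
Lemma nested_segment (D : nat -> R -> R) (c : R) :
  (forall n, continuous (D n)) ->
  (forall n s, 0 <= s <= 1 -> c <= D n.+1 s -> c <= D n s) ->
  (forall n, exists2 s, 0 <= s <= 1 & c <= D n s) ->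
  exists2 s, 0 <= s <= 1 & forall n, c <= D n s.
Proof.
move=> cD Dstep Dex.
have /choice[u uE] : forall n, exists s, 0 <= s <= 1 /\ c <= D n s.
  by move=> n; have [s si cs] := Dex n; exists s.
have Dle m k s : 0 <= s <= 1 -> c <= D (m + k)%N s -> c <= D m s.
  by move=> si; elim: k => [|k IH]; rewrite ?addn0// addnS => /(Dstep _ _ si).
have [|s [si clu]] := @segment_compact R 0 1 (u @ \oo) _.
  by exists 0 => // n _ /=; rewrite in_itv /=; have [] := uE n.
exists s; first by move: si; rewrite /= in_itv.
move=> m; rewrite leNgt; apply/negP => Dm.
have nD : \forall x \near s, D m x < c by apply: cvgr_lt (cD m s) _ Dm.
have um : (u @ \oo) [set x | exists2 n, (m <= n)%N & u n = x].
  by exists m => // n /= mn; exists n.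
have [_ [[n mn <-] /=]] := clu _ _ um nD.
have [ui un] := uE n.
by rewrite ltNge (Dle m (n - m)%N)// subnKC.
Qed.

(** [Num.max 0] retracts the line onto the half-line where [v] is known to be continuous. *)
Lemma angle_lift_lifts (F : R -> A -> A) f n x xi v : isotopy_from_id F f ->
  angle_lift F x xi v ->
  lifts (fun t => annulus_diff (ext F n t) x xi) n%:R (fun t => v (Num.max 0
    t)).
Proof.
move=> hF [cv vE]; split.
  apply: (continuous_retract _ _ cv) => t;
    last by rewrite /= in_itv /= le_max lexx.
  by apply: (@continuous_max R R^o (cst 0) id); [exact: cvg_cst|exact: cvg_id].
move=> t ti; have /andP[t0 _] := ti.
have tE := ext_extended hF ti.
by rewrite (max_r t0) (vE _ t0) tE.
Qed.

Section Map.
Variables (f : A -> A) (F : R -> A -> A).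
Hypothesis negf : negative_torsion_map f.
Hypothesis hF : isotopy_from_id F f.

Lemma turning_neg x : turning (ext F 1) 1 x < 0.
Proof.
have [_ _ /(_ x)] := negf; rewrite /torsion_n.
(* The torsion is computed with some isotopy [G], compared with [F] by [turning_unique]; its default
   value 0 is excluded by negativity. *)
case: xgetP => [tau _ [G [v [hG lv ->]]] tau0|_]; last by rewrite ltxx.
have lG := @angle_lift_lifts G f 1 x chi v hG lv.
have [w [lw w0 ->]] := turning_lift x (ext_smooth hF 1) (@ler01 R).
have e1 : ext F 1 1 = ext G 1 1.
  by rewrite (ext_ge hF) // (ext_ge hG).
have := turning_unique (ext_smooth hF 1) (ext_smooth hG 1) ler01 e1 lw lG.
rewrite w0 subr0 maxxx (max_r (@ler01 R)) => ->.
by move: tau0; rewrite divr1.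
Qed.

(** Induction by the case k = 0 of [turning_step]. *)
Lemma turning_le0 n x : turning (ext F n) n%:R x <= 0.
Proof.
elim: n => [|n IH].
  by have [w [lw w0 ->]] := turning_lift x (ext_smooth hF 0) (lexx 0);
    rewrite w0.
have := turning_step hF (k := 0) (turning_neg _) (n := n) (x := x).
by rewrite mul0r => H; apply/ltW/H.
Qed.

(** By the case k = -1 of [turning_step], a vertical vector that has passed -1/2 never comes
    back. *)
Lemma turning_ge_step n x : - 2^-1 <= turning (ext F n.+1) n.+1%:R x ->
  - 2^-1 <= turning (ext F n) n%:R x.
Proof.
move=> H; rewrite leNgt; apply/negP => lt.
have := turning_step hF (k := -1) (turning_neg _) (n := n) (x := x).
rewrite mulN1r => /(_ (ltW lt)); lra.
Qed.

(** The variation for [chi] lies in [-1/2, 0], and that for [xi] differs from it by at most 1/2 by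
    [lifts_close] used in both orders, so it lies in [-1, 1/2]. *)
Lemma torsion_bound x n xi : xi != 0 -> - 2^-1 <= turning (ext F n) n%:R x ->
  `|torsion_n n f x xi| <= n%:R^-1.
Proof.
move=> xi0 lo; have hi := turning_le0 n x.
have n0 : 0 <= n%:R :> R by rewrite ler0n.
(* The default value 0 satisfies the bound. For n = 0 both sides are 0, as the inverse of 0 is 0. *)
rewrite /torsion_n; case: xgetP => [tau _ [G [v [hG lv ->]]]|_]; last first.
  by rewrite normr0 invr_ge0.
rewrite normrM normfV (ger0_norm n0) ler_piMl ?invr_ge0//.
have lu := angle_lift_lifts n hG lv.
have sG := ext_smooth hG n.
have [w [lw w0 wE]] := turning_lift x sG n0.
have [b [lb b0 bE]] := turning_lift x (ext_smooth hF n) n0.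
have en : ext F n n%:R = ext G n n%:R by rewrite (ext_ge hF) // (ext_ge hG).
have wb := turning_unique (ext_smooth hF n) sG n0 en lb lw.
have [_ CG _] := sG.
have c1 := lifts_close n0 lu lw.
have c2 := lifts_close n0 lw lu.
have nz t : 0 <= t <= n%:R -> annulus_diff (ext G n t) x xi != 0 /\
    chi_field (ext G n) x t != 0.
  move=> _; split; first exact: (annulus_diff_neq0 _ (CG t) xi0).
  exact: (chi_field_neq0 sG).
have {}c1 := c1 nz (fun t _ => etrans (cross_annulus_diff _ _ _ (CG t))
  (esym (cross_annulus_diff _ _ _ (CG 0)))).
have {}c2 := c2 (fun t ti => conj (nz t ti).2 (nz t ti).1)
  (fun t _ => etrans (cross_annulus_diff _ _ _ (CG t))
  (esym (cross_annulus_diff _ _ _ (CG 0)))).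
rewrite maxxx (max_r n0) in c1 c2.
rewrite bE in lo hi; rewrite b0 subr0 in wb; rewrite -wb in c1 c2.
move: c1 c2 lo hi; move: (v n%:R) (v 0) (b n%:R) => p q r.
by clear; rewrite ler_norml; lra.
Qed.

End Map.

End ZeroTorsion.

Theorem theorem3p1 (R : realType) (f : annulus R -> annulus R)
    (gamma : circle R -> annulus R) :
  negative_torsion_map f ->
  essential_curve gamma ->
  (exists phi : circle R -> R, range gamma = graph phi) ->
  exists z : annulus R, range gamma z /\ has_torsion f z 0.
Proof.
move=> negf [[cgamma _ _] _] [phi gphi].
have cphi := graph_continuous cgamma gphi.
have [_ [F hF] _] := negf.
pose x (s : R) : circle R * R := (turn s, phi (turn s)).
have cx : continuous x.
  apply: continuous_pair; first exact: turn_continuous.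
  exact: (continuous_compT (@turn_continuous R) cphi).
have n0 n : 0 <= n%:R :> R by rewrite ler0n.
have /choice[D DE] : forall n, exists D : R -> R, continuous D /\
    forall s, 0 <= s <= 1 -> D s = turning (ext F n) n%:R (x s).
  move=> n; have [D cD DE] := turning_continuous (ext_smooth hF n) (n0 n) cx.
  exists D; split=> // s si; have [v lv ->] := DE s si.
  by rewrite (turningE (n0 n) lv).
(* The nested sets are those of the parameters in [0, 1] where the variation over [0, n] is at least
   -1/2. *)
have [|n s si||s si sD] := @nested_segment R D (- 2^-1).
- by move=> n; have [] := DE n.
- have [_ ->//] := DE n; have [_ ->//] := DE n.+1.
  exact: (turning_ge_step negf hF).
- move=> n; have [_ Dn] := DE n.
  have ch : continuous (fun a => (ext F n n%:R (a, phi a)).2).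
    have c1 : continuous (fun a : circle R => (n%:R : R, (a, phi a))).
      apply: continuous_pair; first exact: cst_continuous.
      by apply: continuous_pair; [move=> a; exact: cvg_id|exact: cphi].
    have c2 := continuous_compT c1 (family_continuous (ext_smooth hF n)).
    by apply: (continuous_compT c2 (g := snd)) => z; exact: cvg_snd.
  (* The set of index n contains the parameter of the point of the graph with the lowest image at
     time n. *)
  have [s0 s0i s0min] := segment_argmin ch.
  exists s0 => //; rewrite Dn//.
  have [v [lv v0 ->]] := turning_lift (x s0) (ext_smooth hF n) (n0 n).
  have := lowest_turn (ext_smooth hF n) (n0 n) cphi s0min lv.
  by rewrite v0 subr0 ltr_norml => /andP[/ltW].
exists (x s); split; first by rewrite gphi.
move=> xi xi0.
have bound n : `|torsion_n n f (x s) xi| <= n%:R^-1.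
  apply: (torsion_bound negf hF xi0).
  by have [_ <-//] := DE n.
apply/cvgrPdist_le => e e0; near=> n; rewrite sub0r normrN.
apply: (le_trans (bound n)).
have n_gt : e^-1 <= n%:R by near: n; exact: nbhs_infty_ger.
rewrite -[e]invrK lef_pV2// posrE ?invr_gt0//.
by rewrite (lt_le_trans _ n_gt)// invr_gt0.
Unshelve. all: by end_near. Qed.
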